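(* Let $\dim V=(n|m)$ and $h\ge0$ an integer. The element $$\sum_L(-1)^{\alpha(L,L)}\,e_s\big(v_{I_h}\otimes v_L\big)\otimes\tilde e_t\big(v^*_L\otimes v^*_{J_h}\big)\in V^{\otimes n(m+h)}\otimes V^{*\otimes m(n+h)}=T^{n(m+h),m(n+h)}(V),$$ where $L$ runs over all sequences of length $nm$ with entries in $R_V$, is $\mathfrak{sl}(V)$-invariant. (This is the element $e_s\times\tilde e_t(v_{I_h}\otimes\theta_{nm}\otimes v^*_{J_h})$.)
   Context: $V$ has homogeneous basis $e_i$, $i\in R_V=\{1,\dots,n,\bar1,\dots,\bar m\}$ (barred indices odd), $e_i^*$ the left dual basis; $v_I=e_{i_1}\otimes\dots\otimes e_{i_N}$, $v^*_I=e^*_{i_1}\otimes\dots\otimes e^*_{i_N}$; $\alpha(L,L)=\sum_{i<j}p(l_i)p(l_j)$. $\mathfrak S_N$ acts on $X^{\otimes N}$ ($X=V,V^*$) by $\sigma v_I=c(I,\sigma^{-1})v_{\sigma I}$, with $c(I,\sigma)=\pm1$ defined by $x_{\sigma^{-1}I}=c(I,\sigma)x_I$ in the free supercommutative algebra on generators $x_i$ of parity $p(i)$. $e_t=\sum_{\tau\in C_t,\sigma\in R_t}\varepsilon(\tau)\sigma\tau$, $\tilde e_t=\sum_{\tau\in C_t,\sigma\in R_t}\varepsilon(\tau)\tau\sigma$. $t$: rectangular tableau with $n+h$ rows and $m$ columns, first $n$ rows filled with $1,\dots,nm$ column by column, last $h$ rows with $nm+1,\dots,nm+hm$ column by column. $s$: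 tableau with $n$ rows and $h+m$ columns, first $h$ columns filled with $1,\dots,hn$ column by column, last $m$ columns with $hn+1,\dots,hn+mn$ column by column. $I_h$: the sequence $1,\dots,n$ repeated $h$ times; $J_h$: $h$ copies of $\bar1$, then $h$ copies of $\bar2$, ..., $h$ copies of $\bar m$. $e_s$ acts on the $V$-factors, $\tilde e_t$ on the $V^*$-factors. *)

(* Defs.v *)
From HB Require Import structures.
From mathcomp Require Import all_boot all_order all_algebra all_fingroup.
Set Implicit Arguments. Unset Strict Implicit. Unset Printing Implicit Defensive.
Import GRing.Theory.
Local Open Scope ring_scope.

(* Super vector space V of dimension (n|m) over F, homogeneous basis indexed by
   R_V = 'I_(n+m): indices 0..n-1 are the even indices 1..n, indices
   n..n+m-1 are the odd indices 1bar..mbar. *)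
Definition par (n m : nat) (i : 'I_(n+m)) : bool := (n <= i)%N.

Notation mi n m N := {ffun 'I_N -> 'I_(n+m)}.
(* X^{(x) N} (X = V or Vdual) in coordinates: coefficient of v_I (resp. vdual_I) *)
Notation tens F n m N := {ffun mi n m N -> F^o}.
Definition basis (F : fieldType) n m N (I : mi n m N) : tens F n m N :=
  [ffun J => (J == I)%:R].

Definition pact n m N (s : 'S_N) (I : mi n m N) : mi n m N :=
  [ffun k => I ((s^-1)%g k)].

(* c(I,sigma): x_{sigma^{-1} I} = c(I,sigma) x_I in the free supercommutative
   algebra; x_{sigma^{-1} I} = x_{i_sigma(1)} ... x_{i_sigma(N)}, and reordering
   gives the sign (-1)^(number of inversions of sigma between odd entries). *)
Definition csign (F : fieldType) n m N (I : mi n m N) (s : 'S_N) : F :=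
  (-1) ^+ #|[set ab : 'I_N * 'I_N |
      [&& (ab.1 < ab.2)%N, (s ab.2 < s ab.1)%N,
          par (I (s ab.1)) & par (I (s ab.2))]]|.

Definition permact (F : fieldType) n m N (s : 'S_N) (x : tens F n m N)
  : tens F n m N :=
  \sum_(I : mi n m N) (x I * csign F I (s^-1)%g) *: basis F (pact s I).

(* Row and column groups of a tableau given by row/column position functions
   (positions 0..N-1 stand for the entries 1..N). *)
Definition Rgrp N (row : nat -> nat) : {set 'S_N} :=
  [set s : 'S_N | [forall k : 'I_N, row (s k) == row k]].

Definition sgnF (F : fieldType) N (t : 'S_N) : F := (-1) ^+ odd_perm t.

Definition ysym (F : fieldType) n m N (row col : nat -> nat) (x : tens F n m N)
  : tens F n m N :=
  \sum_(tau in Rgrp N col) \sum_(sg in Rgrp N row)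
     sgnF F tau *: permact sg (permact tau x).

Definition ysymt (F : fieldType) n m N (row col : nat -> nat) (x : tens F n m N)
  : tens F n m N :=
  \sum_(tau in Rgrp N col) \sum_(sg in Rgrp N row)
     sgnF F tau *: permact tau (permact sg x).

(* Tableau s : n rows, h+m columns, filled column by column with 1..n(h+m)
   (first h columns with 1..hn, then last m columns with hn+1..hn+mn). *)
Definition s_row (n : nat) (k : nat) : nat := (k %% n)%N.
Definition s_col (n : nat) (k : nat) : nat := (k %/ n)%N.

(* Tableau t : n+h rows, m columns; first n rows filled column by column with
   1..nm, last h rows filled column by column with nm+1..nm+hm. *)
Definition t_row (n m h : nat) (k : nat) : nat :=
  (if k < n * m then k %% n else n + (k - n * m) %% h)%N.
Definition t_col (n m h : nat) (k : nat) : nat :=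
  (if k < n * m then k %/ n else (k - n * m) %/ h)%N.

Definition catmi n m p q (a : mi n m p) (b : mi n m q) : mi n m (p + q) :=
  [ffun k => match split k with inl i => a i | inr j => b j end].

Lemma Ih_lt n m h k : (k < n * h)%N -> (k %% n < n + m)%N.
Proof.
case: n => [|n]; first by rewrite mul0n.
by move=> _; apply: leq_trans (ltn_pmod _ _) (leq_addr _ _).
Qed.

Lemma Jh_lt n m h k : (k < h * m)%N -> (n + k %/ h < n + m)%N.
Proof.
case: h => [|h]; first by rewrite mul0n.
by move=> Hk; rewrite ltn_add2l ltn_divLR // mulnC.
Qed.

(* I_h = 1,...,n repeated h times *)
Definition Ih n m h : mi n m (n * h) := [ffun k => Ordinal (Ih_lt m (ltn_ord k))].
(* J_h = h copies of 1bar, then h copies of 2bar, ..., h copies of mbar *)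
Definition Jh n m h : mi n m (h * m) := [ffun k => Ordinal (Jh_lt n (ltn_ord k))].

Definition alpha n m N (L : mi n m N) : nat :=
  (\sum_(i < N) \sum_(j < N | (i < j)%N) par (L i) * par (L j))%N.

(* mixed tensors T^{p,q}(V) = V^{(x)p} (x) Vdual^{(x)q}: coefficient of v_I (x) vdual_K *)
Notation mtens F n m p q := {ffun mi n m p * mi n m q -> F^o}.
Definition mbasis (F : fieldType) n m p q (I : mi n m p) (K : mi n m q)
  : mtens F n m p q := [ffun JK => ((JK.1 == I) && (JK.2 == K))%:R].
Definition tprod (F : fieldType) n m p q (x : tens F n m p) (y : tens F n m q)
  : mtens F n m p q := [ffun JK => x JK.1 * y JK.2].

Definition upd n m N (I : mi n m N) (a : 'I_N) (r : 'I_(n+m)) : mi n m N :=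
  [ffun k => if k == a then r else I k].

(* Action of a homogeneous X in gl(V) of parity b (X e_j = sum_i X_ij e_i,
   X edual_j = -(-1)^{b p(j)} sum_k X_jk edual_k) on the basis tensor
   e_{i_1}..e_{i_p} edual_{k_1}..edual_{k_q}, via the super Leibniz rule. *)
Definition actb (F : fieldType) n m (b : bool) (X : 'M[F]_(n+m)) p q
  (I : mi n m p) (K : mi n m q) : mtens F n m p q :=
  \sum_(a < p) \sum_(r : 'I_(n+m))
     ((-1) ^+ (b * (\sum_(a' < p | (a' < a)%N) par (I a')))%N * X r (I a))
       *: mbasis F (upd I a r) K
  + \sum_(c < q) \sum_(r : 'I_(n+m))
     ((-1) ^+ (b * ((\sum_(a < p) par (I a))
                     + \sum_(c' < q | (c' < c)%N) par (K c')))%N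
      * (- ((-1) ^+ (b * par (K c))%N * X (K c) r)))
       *: mbasis F I (upd K c r).

Definition mact (F : fieldType) n m (b : bool) (X : 'M[F]_(n+m)) p q
  (w : mtens F n m p q) : mtens F n m p q :=
  \sum_(IK : mi n m p * mi n m q) w IK *: actb b X IK.1 IK.2.

Definition homogeneous (F : fieldType) n m (b : bool) (X : 'M[F]_(n+m)) : Prop :=
  forall i j, addb (par i) (par j) != b -> X i j = 0.

Definition str (F : fieldType) n m (X : 'M[F]_(n+m)) : F :=
  \sum_(i : 'I_(n+m)) (-1) ^+ par i * X i i.

Definition sl_invariant (F : fieldType) n m p q (w : mtens F n m p q) : Prop :=
  forall (b : bool) (X : 'M[F]_(n+m)),
    homogeneous b X -> str X = 0 -> mact b X w = 0.

(* Main.v *)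
(** Write [theta := \sum_L (-1)^alpha(L) v_L (x) v*_L]. The super-Leibniz action of gl(V)
    commutes with the signed action of the symmetric groups and kills [theta], so that
    [x (x) y |-> (e_s x e~_t) (x (x) theta (x) y)] is equivariant. Hence [X] acts on the
    element [w] of the theorem only through [v_Ih] and [v*_Jh].

    - If [X] is even, a repeated even label in a column of [s], or a repeated odd label in a
      row of [t], kills the off-diagonal contributions, and [X w = h str(X) w].
    - If [X] sends odd vectors to even ones (is raising), it kills [v_Ih] and [v*_Jh].
    - If [X] sends even vectors to odd ones (is lowering), put [w' := X w]. Every raising [Y]
      kills [w'], because [[Y, X]] is even of supertrace 0. The coefficients of [w'] without
      odd entries in the [V]-factors vanish, by counting the even entries in the columns of
      [t]. Finally [w'] is symmetric along the [n] rows of [s] in its [V]-factors, and raising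
      operators can move the odd entries of such a tensor to the even label given by their
      row: by induction on the number of entries that differ from this label, [w' = 0]. *)

From HB Require Import structures.
From mathcomp Require Import all_boot all_order all_algebra all_fingroup zify.
(* [Defs] comes last because fingroup has another [mact]. *)
Require Import Defs.
Set Implicit Arguments. Unset Strict Implicit. Unset Printing Implicit Defensive.
Import GRing.Theory.
Local Open Scope ring_scope.

Local Notation bilinear_map f :=
  (bilinear_for (GRing.Scale.Law.clone _ _ *:%R _) (GRing.Scale.Law.clone _ _ *:%R _) f).

(** * Parities and signs *)

Lemma signr_sum (R : pzRingType) (I : finType) (P : pred I) (f : I -> bool) :
  (-1) ^+ (\sum_(i | P i) f i)%N = (-1) ^+ (\big[addb/false]_(i | P i) f i) :> R.
Proof.
rewrite -signr_odd (big_morph odd oddD (erefl _)).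
by congr ((-1) ^+ nat_of_bool _); apply: eq_bigr => i _; rewrite oddb.
Qed.

Lemma ord_ltNge N (a b : 'I_N) : a != b -> (a < b)%N = ~~ (b < a)%N.
Proof. by rewrite -leqNgt ltn_neqAle => ->. Qed.

Section IncreasingPairs.
Variables (R : Type) (idx : R) (op : Monoid.com_law idx) (N : nat).

Lemma big_increasing_pairs_perm (s : 'S_N) (f : 'I_N -> 'I_N -> R) :
    (forall a b, f a b = f b a) ->
  \big[op/idx]_(ab : 'I_N * 'I_N | (ab.1 < ab.2)%N) f (s ab.1) (s ab.2) =
  \big[op/idx]_(ab : 'I_N * 'I_N | (ab.1 < ab.2)%N) f ab.1 ab.2.
Proof.
move=> fC; pose sort (ab : 'I_N * 'I_N) := (s ab.1 < s ab.2)%N.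
have perm_pair_inj : injective (fun ab : 'I_N * 'I_N => (s ab.1, s ab.2)).
  by move=> [a b] [c d] [/perm_inj-> /perm_inj->].
rewrite [RHS](reindex_inj perm_pair_inj) (bigID sort).
rewrite [RHS](bigID (fun ab : 'I_N * 'I_N => (ab.1 < ab.2)%N)) /=; congr (op _ _).
  by apply: eq_bigl => ab; rewrite andbC.
rewrite [LHS](reindex_inj (can_inj (@swap_pairK _ _))).
apply: eq_big => [[a b]|[a b] _] /=; last exact: fC.
rewrite /sort /=; have [->|neq_ab] := eqVneq a b; first by rewrite !ltnn.
have neq_sab : s a != s b by rewrite (inj_eq perm_inj).
by rewrite (ord_ltNge neq_ab) (ord_ltNge neq_sab) negbK andbC.
Qed.

Lemma big_increasing_pairs_point (c : 'I_N) (f : 'I_N -> R) :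
  \big[op/idx]_(ab : 'I_N * 'I_N | (ab.1 < ab.2)%N)
    op (if ab.2 == c then f ab.1 else idx) (if ab.1 == c then f ab.2 else idx) =
  \big[op/idx]_(a | a != c) f a.
Proof.
rewrite big_split -!big_mkcondr (bigID (fun a : 'I_N => (a < c)%N)) /=.
congr (op _ _).
  rewrite (reindex_onto (fun a => (a, c)) fst) /= => [|[a b] /= /andP[_ /eqP->] //].
  apply: eq_bigl => a; rewrite !eqxx andbT andbT -val_eqE /=.
  by case: ltngtP.
rewrite (reindex_onto (fun a => (c, a)) snd) /= => [|[a b] /= /andP[_ /eqP->] //].
apply: eq_bigl => a; rewrite !eqxx andbT andbT -val_eqE /=.
by case: ltngtP.
Qed.

End IncreasingPairs.

Section Parities.
Variable N : nat.
Implicit Types (p : {ffun 'I_N -> bool}) (w : rel 'I_N) (s u v : 'S_N).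
Implicit Types (a b c k l : 'I_N) (e : bool).

Definition parity p : bool := \big[addb/false]_a p a.
Definition parity_before p c : bool := \big[addb/false]_(a < N | (a < c)%N) p a.
Definition toggle p c e : {ffun 'I_N -> bool} := [ffun a => p a (+) ((a == c) && e)].
Definition pull s p : {ffun 'I_N -> bool} := [ffun a => p (s a)].

Lemma big_addb_point (P : pred 'I_N) c e :
  \big[addb/false]_(a | P a) ((a == c) && e) = P c && e.
Proof.
rewrite big_mkcond (bigD1 c) //= eqxx big1 => [|a /negPf->]; first by rewrite addbF.
by case: (P a).
Qed.

Lemma toggle_false p c : toggle p c false = p.
Proof. by apply/ffunP => a; rewrite ffunE andbF addbF. Qed.

Lemma parity_pull s p : parity (pull s p) = parity p.
Proof.
rewrite [RHS](reindex_inj (@perm_inj _ s)).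
by apply: eq_bigr => a _; rewrite ffunE.
Qed.

Lemma pullK s : cancel (pull s) (pull s^-1%g).
Proof. by move=> p; apply/ffunP => a; rewrite !ffunE permKV. Qed.

Lemma pull_toggle s p c e : pull s (toggle p c e) = toggle (pull s p) (s^-1%g c) e.
Proof. by apply/ffunP => a; rewrite !ffunE -(inj_eq (@perm_inj _ s) a) permKV. Qed.

Lemma parity_toggle p c e : parity (toggle p c e) = parity p (+) e.
Proof.
rewrite -[e in RHS](big_addb_point predT c) -big_split.
by apply: eq_bigr => a _; rewrite ffunE.
Qed.

Lemma parity_before_toggle p c e a :
  parity_before (toggle p c e) a = parity_before p a (+) ((c < a)%N && e).
Proof.
rewrite -(big_addb_point (fun b => b < a)%N) -big_split.
by apply: eq_bigr => b _; rewrite ffunE.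
Qed.

(* A quadratic form over F_2 in [p]; [parity_pairs_toggle] is its polarization. *)
Definition parity_pairs w p : bool :=
  \big[addb/false]_(ab : 'I_N * 'I_N | (ab.1 < ab.2)%N) [&& w ab.1 ab.2, p ab.1 & p ab.2].

Lemma parity_pairs_toggle w p c e : symmetric w ->
  parity_pairs w (toggle p c e) =
  parity_pairs w p (+) (e && \big[addb/false]_(a | a != c) (w a c && p a)).
Proof.
move=> wC; case: e => /=; last by rewrite toggle_false addbF.
rewrite -big_increasing_pairs_point -big_split; apply: eq_bigr => -[a b] /= lt_ab.
rewrite !ffunE; have [eb|] := eqVneq b c; have [ea|] := eqVneq a c => /=.
- by rewrite ea eb ltnn in lt_ab.
- by rewrite eb !addbF addbT; case: (w a c) (p a) (p c) => [] [] [].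
- by rewrite ea (wC b c) addbF addbT; case: (w c b) (p b) (p c) => [] [] [].
by rewrite !addbF.
Qed.

Definition crosses u a b : bool := (a < b)%N (+) (u a < u b)%N.
Definition inversion_parity u p : bool := parity_pairs (crosses u) p.

Lemma crosses_sym u : symmetric (crosses u).
Proof.
move=> a b; rewrite /crosses; have [->//|neq_ab] := eqVneq a b.
have neq_uab : u a != u b by rewrite (inj_eq perm_inj).
by rewrite (ord_ltNge neq_ab) (ord_ltNge neq_uab) addNb addbN negbK.
Qed.

Lemma crossesM u v a b : crosses (u * v)%g a b = crosses u a b (+) crosses v (u a) (u b).
Proof. by rewrite /crosses !permM addbA addbK. Qed.

Lemma inversion_parityM u v p :
  inversion_parity (u * v)%g p = inversion_parity u p (+) inversion_parity v (pull u^-1%g p).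
Proof.
rewrite /inversion_parity [X in _ (+) X]/parity_pairs.
rewrite -(big_increasing_pairs_perm _ u (f := fun a b => [&& crosses v a b, _ a & _ b])).
  rewrite -big_split; apply: eq_bigr => ab _.
  by rewrite crossesM andb_addl !ffunE !permK.
by move=> a b; rewrite crosses_sym [X in _ && X = _]andbC.
Qed.

Lemma inversion_parity_toggle u p c e :
  inversion_parity u (toggle p c e) =
  inversion_parity u p (+) (e && (parity_before p c (+) parity_before (pull u^-1%g p) (u c))).
Proof.
rewrite /inversion_parity parity_pairs_toggle; last exact: crosses_sym.
congr (_ (+) (_ && _)); rewrite /parity_before.
rewrite [X in _ = _ (+) X](reindex_inj (@perm_inj _ u)) /=.
rewrite big_mkcond [X in _ = X (+) _]big_mkcond [X in _ = _ (+) X]big_mkcond -big_split /=.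
apply: eq_bigr => a _; rewrite ffunE permK /crosses.
have [->|_ /=] := eqVneq a c; first by rewrite !ltnn.
by case: (a < c)%N; case: (u a < u c)%N; case: (p a).
Qed.

Lemma inversion_parity_tperm k l p :
  k != l -> p k = p l -> inversion_parity (tperm k l) p = p k.
Proof.
move=> neq_kl eq_p; set u := tperm k l.
have [o [pE o_k o_l]] : exists o,
    [/\ p = toggle (toggle o l (p k)) k (p k), o k = false & o l = false].
  exists (toggle (toggle p k (p k)) l (p k)); split.
  - by apply/ffunP => a; rewrite !ffunE !(addbAC _ ((a == l) && _)) !addbK.
  - by rewrite !ffunE eqxx (negPf neq_kl) addbF addbb.
  by rewrite !ffunE eqxx eq_sym (negPf neq_kl) addbF eq_p addbb.
have inv_o : inversion_parity u o = false.
  apply: big1 => -[a b] /= lt_ab; rewrite /crosses lt_ab /u.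
  case: tpermP => [->|->|_ _]; rewrite ?o_k ?o_l ?andbF //.
  by case: tpermP => [->|->|_ _]; rewrite ?o_k ?o_l ?andbF // lt_ab.
have pull_o : pull u o = o.
  by apply/ffunP => a; rewrite ffunE /u; case: tpermP => [->|->|//]; rewrite o_k o_l.
rewrite {1}pE !inversion_parity_toggle inv_o tpermV pull_toggle pull_o.
rewrite !parity_before_toggle tpermV tpermL tpermR (ord_ltNge neq_kl).
by case: (p k) (parity_before o k) (parity_before o l) (l < k)%N => [] [] [] [].
Qed.

End Parities.

(** * Super-derivations of tensor powers *)

Lemma ffun_scaleE (F : fieldType) (T : finType) (k : F) (x : {ffun T -> F^o}) i :
  (k *: x) i = k * x i.
Proof. by rewrite ffunE. Qed.

Lemma ffun_addE (F : fieldType) (T : finType) (x y : {ffun T -> F^o}) i :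
  (x + y) i = x i + y i.
Proof. by rewrite ffunE. Qed.

Section MultiIndices.
Variables n m N : nat.
Implicit Types (I J L : mi n m N) (a c : 'I_N) (i j r : 'I_(n + m)) (s t : 'S_N) (b : bool).

Definition odd_at I : {ffun 'I_N -> bool} := [ffun a => par (I a)].

Lemma odd_atE I a : odd_at I a = par (I a).
Proof. by rewrite ffunE. Qed.

Lemma upd_id I a : upd I a (I a) = I.
Proof. by apply/ffunP => k; rewrite ffunE; case: eqP => [->|]. Qed.

Lemma upd_at I a r : upd I a r a = r.
Proof. by rewrite ffunE eqxx. Qed.

Lemma upd_ne I a r c : c != a -> upd I a r c = I c.
Proof. by rewrite ffunE => /negPf ->. Qed.

Lemma upd_upd I a i j : upd (upd I a i) a j = upd I a j.
Proof. by apply/ffunP => k; rewrite !ffunE; case: eqP. Qed.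

Lemma updC I a c i j : a != c -> upd (upd I a i) c j = upd (upd I c j) a i.
Proof.
move=> neq_ac; apply/ffunP => k; rewrite !ffunE; case: eqP => // ->.
by rewrite eq_sym (negPf neq_ac).
Qed.

Lemma odd_at_upd I a r : odd_at (upd I a r) = toggle (odd_at I) a (par (I a) (+) par r).
Proof.
apply/ffunP => c; rewrite !ffunE; case: eqP => [->|_]; last by rewrite addbF.
by rewrite addKb.
Qed.

Lemma signr_parity (R : pzRingType) b I :
  (-1) ^+ (b * (\sum_a par (I a)))%N = (-1) ^+ (b && parity (odd_at I)) :> R.
Proof.
case: b; rewrite ?mul0n // mul1n signr_sum; congr (_ ^+ nat_of_bool _).
by apply: eq_bigr => a _; rewrite ffunE.
Qed.

Lemma signr_parity_before (R : pzRingType) b I c :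
  (-1) ^+ (b * (\sum_(a < N | (a < c)%N) par (I a)))%N =
  (-1) ^+ (b && parity_before (odd_at I) c) :> R.
Proof.
case: b; rewrite ?mul0n // mul1n signr_sum; congr (_ ^+ nat_of_bool _).
by apply: eq_bigr => a _; rewrite ffunE.
Qed.

Lemma pactVE s J a : pact s^-1%g J a = J (s a).
Proof. by rewrite ffunE invgK. Qed.

Lemma pactK s : cancel (@pact n m N s) (pact s^-1%g).
Proof. by move=> J; apply/ffunP => k; rewrite !ffunE invgK permK. Qed.

Lemma pactKV s : cancel (@pact n m N s^-1%g) (pact s).
Proof. by move=> J; apply/ffunP => k; rewrite !ffunE invgK permKV. Qed.

Lemma pactM s t J : pact (s * t)%g J = pact t (pact s J).
Proof. by apply/ffunP => k; rewrite !ffunE invMg permM. Qed.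

Lemma upd_pactV s J a i : upd (pact s^-1%g J) a i = pact s^-1%g (upd J (s a) i).
Proof. by apply/ffunP => k; rewrite !ffunE !invgK (inj_eq perm_inj). Qed.

Lemma odd_at_pactV s J : odd_at (pact s^-1%g J) = pull s (odd_at J).
Proof. by apply/ffunP => a; rewrite !ffunE invgK. Qed.

Lemma sum_upd_swap (V : nmodType) a (G : mi n m N -> 'I_(n + m) -> V) :
  \sum_I \sum_r G I r = \sum_I \sum_r G (upd I a r) (I a).
Proof.
rewrite !pair_bigA /=.
rewrite (reindex_inj (h := fun Ir => (upd Ir.1 a Ir.2, Ir.1 a))) //=.
apply: (can_inj (g := fun Ir => (upd Ir.1 a Ir.2, Ir.1 a))) => -[I r] /=.
by rewrite upd_upd upd_id upd_at.
Qed.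

End MultiIndices.

Section SuperMatrices.
Variables (F : fieldType) (n m : nat).
Implicit Types (b : bool) (A B X Y : 'M[F]_(n + m)).

Definition supercomm b b' A B : 'M[F]_(n + m) := A *m B - (-1) ^+ (b && b') *: (B *m A).

Lemma homogeneous_entry b A i j :
  homogeneous b A -> A i j != 0 -> par i (+) par j = b.
Proof. by move=> hA; apply: contraNeq => /hA->. Qed.

Lemma homogeneousM b b' A B :
  homogeneous b A -> homogeneous b' B -> homogeneous (b (+) b') (A *m B).
Proof.
move=> hA hB i j; apply: contraNeq; rewrite mxE.
apply: contraR => not_par; rewrite big1 // => k _; apply/eqP; rewrite mulf_eq0.
apply: contraNT not_par; rewrite negb_or => /andP[Aik Bkj].
by rewrite -(homogeneous_entry hA Aik) -(homogeneous_entry hB Bkj) addbA addbK eqxx.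
Qed.

Lemma homogeneous_supercomm b b' A B : homogeneous b A -> homogeneous b' B ->
  homogeneous (b (+) b') (supercomm b b' A B).
Proof.
move=> hA hB i j not_par; have AB0 := homogeneousM hA hB not_par.
have BA0 : (B *m A) i j = 0 by apply: (homogeneousM hB hA); rewrite (addbC b').
by rewrite !mxE in AB0 BA0 *; rewrite AB0 BA0 mulr0 subr0.
Qed.

Lemma str_supercomm b b' A B :
  homogeneous b A -> homogeneous b' B -> str (supercomm b b' A B) = 0.
Proof.
move=> hA hB; rewrite /str; under eq_bigr => i _ do rewrite !mxE mulrBr mulrCA !mulr_sumr.
rewrite sumrB [X in _ - X]exchange_big -sumrB big1 //= => i _; rewrite -sumrB big1 // => k _.
have [->|Aik] := eqVneq (A i k) 0; first by rewrite !(mul0r, mulr0) subrr.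
have [->|Bki] := eqVneq (B k i) 0; first by rewrite !(mul0r, mulr0) subrr.
have <- := homogeneous_entry hA Aik; have <- := homogeneous_entry hB Bki.
rewrite (mulrC (B k i)) !mulrA -signr_addb -mulrBl.
by case: (par i) (par k) => [] []; rewrite subrr mul0r.
Qed.

(* The matrix by which [X] acts on the dual basis, see [actb]. *)
Definition dualmx b X : 'M[F]_(n + m) := \matrix_(r, k) (- ((-1) ^+ (b && par k) * X k r)).

Lemma dualmx_is_linear b : linear (dualmx b).
Proof. by move=> k X Y; apply/matrixP => i j; rewrite !mxE mulrDr opprD mulrCA mulrN. Qed.
HB.instance Definition _ b :=
  GRing.isLinear.Build F 'M[F]_(n + m) 'M[F]_(n + m) _ (dualmx b) (dualmx_is_linear b).

Lemma homogeneous_dualmx b X : homogeneous b X -> homogeneous b (dualmx b X).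
Proof. by move=> hX i j not_par; rewrite mxE hX ?mulr0 ?oppr0 // addbC. Qed.

Lemma dualmxM b b' X Y : homogeneous b X -> homogeneous b' Y ->
  dualmx b X *m dualmx b' Y = - (-1) ^+ (b && b') *: dualmx (b (+) b') (Y *m X).
Proof.
move=> hX hY; apply/matrixP => r k; rewrite !mxE mulrNN mulrA mulr_sumr.
apply: eq_bigr => l _; rewrite !mxE mulrNN.
have [->|Ykl] := eqVneq (Y k l) 0; first by rewrite !(mul0r, mulr0).
have := homogeneous_entry hY Ykl; rewrite addbC => /(canRL (addbK _)) ->.
rewrite mulrACA -!signr_addb (mulrC (X l r)) !mulrA; congr (_ ^+ nat_of_bool _ * _ * _).
by case: b b' (par k) {hX hY} => [] [] [].
Qed.

Lemma dualmx_supercomm b b' X Y : homogeneous b X -> homogeneous b' Y ->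
  supercomm b b' (dualmx b X) (dualmx b' Y) = dualmx (b (+) b') (supercomm b b' X Y).
Proof.
move=> hX hY; rewrite /supercomm !dualmxM // (andbC b') (addbC b').
rewrite linearB (linearZ_LR (dualmx _)) /= !scaleNr scalerN opprK.
by rewrite scalerA -signr_addb addbb scale1r addrC.
Qed.

End SuperMatrices.

Section Tensors.
Variables (F : fieldType) (n m N : nat).
Implicit Types (x y : tens F n m N) (I J L : mi n m N) (a c : 'I_N).
Implicit Types (b : bool) (s t : 'S_N) (A B : 'M[F]_(n + m)).

Lemma basisE I J : basis F I J = (J == I)%:R.
Proof. by rewrite ffunE. Qed.

Lemma tens_sum_basis x : x = \sum_I x I *: basis F I.
Proof.
apply/ffunP => J; rewrite sum_ffunE (bigD1 J) //= !ffunE eqxx big1 => [|I neI].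
  by rewrite addr0 [RHS]mulr1.
by rewrite !ffunE eq_sym (negPf neI) [LHS]mulr0.
Qed.

Lemma csignE I s : csign F I s = (-1) ^+ inversion_parity s (pull s (odd_at I)).
Proof.
rewrite /csign -sum1dep_card big_mkcondr /= -signr_sum.
congr (_ ^+ _); apply: eq_bigr => ab lt_ab; rewrite !ffunE /crosses lt_ab addTb.
rewrite -ord_ltNge; first by case: ifP.
by rewrite (inj_eq perm_inj) -val_eqE /= eq_sym ltn_eqF.
Qed.

Lemma permactE s x J :
  permact s x J = (-1) ^+ inversion_parity s^-1%g (odd_at J) * x (pact s^-1%g J).
Proof.
rewrite /permact sum_ffunE (bigD1 (pact s^-1%g J)) //= big1 => [|I neI].
  by rewrite !ffunE addr0 pactKV eqxx [LHS]mulr1 csignE mulrC odd_at_pactV pullK.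
rewrite !ffunE; case: eqP => [eJ|_]; last exact: mulr0.
by rewrite eJ pactK eqxx in neI.
Qed.

Lemma permact_is_linear s : linear (@permact F n m N s).
Proof.
by move=> k x y; apply/ffunP => J; rewrite !(permactE, ffunE) /GRing.scale /= mulrDr mulrCA.
Qed.
HB.instance Definition _ s :=
  GRing.isLinear.Build F (tens F n m N) (tens F n m N) _ (@permact F n m N s)
    (permact_is_linear s).

Lemma permactM s t x : permact s (permact t x) = permact (t * s)%g x.
Proof.
apply/ffunP => J; rewrite !permactE odd_at_pactV invMg inversion_parityM invgK pactM.
by rewrite mulrA -signr_addb.
Qed.

Lemma permact_basis s I :
  permact s (basis F I) =
  (-1) ^+ inversion_parity s^-1%g (odd_at (pact s I)) *: basis F (pact s I).
Proof.
apply/ffunP => J; rewrite permactE !ffunE [RHS]mulrC [LHS]mulrC.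
have [->|neJ] := eqVneq J (pact s I); first by rewrite pactK eqxx.
by rewrite (can2_eq (pactKV s) (@pactK _ _ _ s)) (negPf neJ) !mul0r.
Qed.

Lemma permact_tperm_basis I k l : k != l -> I k = I l ->
  permact (tperm k l) (basis F I) = (-1) ^+ par (I k) *: basis F I.
Proof.
move=> neq_kl eq_I.
have pactI : pact (tperm k l) I = I.
  by apply/ffunP => c; rewrite ffunE tpermV; case: tpermP => [->|->|].
by rewrite permact_basis pactI tpermV inversion_parity_tperm ?odd_atE // eq_I.
Qed.

(* [1 (x) .. (x) A (x) .. (x) 1] with [A], of parity [b], in position [a]; the sign is
   that of moving [A] past the factors on its left. *)
Definition site_act b a A x : tens F n m N :=
  [ffun J => \sum_i (-1) ^+ (b && parity_before (odd_at J) a) * A (J a) i * x (upd J a i)].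

Lemma site_actE b a A x J : site_act b a A x J =
  \sum_i (-1) ^+ (b && parity_before (odd_at J) a) * A (J a) i * x (upd J a i).
Proof. by rewrite ffunE. Qed.

Fact site_act_is_bilinear b a : bilinear_map (site_act b a).
Proof.
split=> [x|A] k u v; apply/ffunP => J.
  rewrite ffun_addE ffun_scaleE !site_actE mulr_sumr -big_split; apply: eq_bigr => i _.
  by rewrite !mxE mulrDr mulrDl /= !mulrA (mulrC k).
rewrite ffun_addE ffun_scaleE !site_actE mulr_sumr -big_split; apply: eq_bigr => i _.
by rewrite ffun_addE ffun_scaleE mulrDr mulrCA.
Qed.
HB.instance Definition _ b a :=
  bilinear_isBilinear.Build F 'M[F]_(n + m) (tens F n m N) (tens F n m N) _ _ (site_act b a)
    (site_act_is_bilinear b a).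

Lemma permact_site_act b a A s x : homogeneous b A ->
  permact s (site_act b a A x) = site_act b (s a) A (permact s x).
Proof.
move=> hA; apply/ffunP => J; rewrite permactE !site_actE mulr_sumr; apply: eq_bigr => i _.
rewrite pactVE permactE upd_pactV odd_at_upd odd_at_pactV inversion_parity_toggle invgK permK.
have [->|Aji] := eqVneq (A (J (s a)) i) 0; first by rewrite !(mulr0, mul0r).
rewrite (homogeneous_entry hA Aji) !mulrA; congr (_ * _).
rewrite [RHS]mulrAC -!signr_addb; congr (_ ^+ nat_of_bool _ * _).
by rewrite [RHS]addbCA andb_addr addKb.
Qed.

Lemma site_act_comm b b' A B a c x : homogeneous b A -> homogeneous b' B -> a != c ->
  site_act b a A (site_act b' c B x) = (-1) ^+ (b && b') *: site_act b' c B (site_act b a A x).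
Proof.
move=> hA hB neq_ac; apply/ffunP => J; rewrite [RHS]ffunE !site_actE.
under eq_bigr => i _ do rewrite site_actE mulr_sumr.
rewrite exchange_big [RHS]mulr_sumr; apply: eq_bigr => k _; rewrite site_actE !mulr_sumr.
apply: eq_bigr => i _.
rewrite (upd_ne J i (_ : c != a)) 1?eq_sym // (upd_ne J k neq_ac) (updC J i k neq_ac).
have [->|Aji] := eqVneq (A (J a) i) 0; first by rewrite !(mulr0, mul0r).
have [->|Bjk] := eqVneq (B (J c) k) 0; first by rewrite !(mulr0, mul0r).
rewrite !odd_at_upd !parity_before_toggle (ord_ltNge neq_ac).
rewrite (homogeneous_entry hA Aji) (homogeneous_entry hB Bjk) !mulrA; congr (_ * _).
rewrite [X in X * _ = _]mulrAC [X in _ = X * _]mulrAC [RHS]mulrAC -!signr_addb.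
congr (_ ^+ nat_of_bool _ * _ * _).
by case: b b' (parity_before _ a) (parity_before _ c) (c < a)%N {hA hB} => [] [] [] [] [].
Qed.

Lemma site_act_mul b b' a A B x :
  site_act b a A (site_act b' a B x) = site_act (b (+) b') a (A *m B) x.
Proof.
apply/ffunP => J; rewrite !site_actE.
under eq_bigr => i _ do rewrite site_actE mulr_sumr.
rewrite exchange_big /=; apply: eq_bigr => k _; rewrite mxE mulr_sumr mulr_suml.
apply: eq_bigr => i _.
rewrite upd_at upd_upd odd_at_upd parity_before_toggle ltnn addbF andb_addl signr_addb.
by rewrite !mulrA [X in X * _ * _]mulrAC.
Qed.

Lemma site_act_delta b a i j x J :
  site_act b a (delta_mx i j) x J =
  if J a == i then (-1) ^+ (b && parity_before (odd_at J) a) * x (upd J a j) else 0.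
Proof.
rewrite site_actE (bigD1 j) //= big1 => [|k neq_kj]; last first.
  by rewrite mxE (negPf neq_kj) andbF mulr0 mul0r.
by rewrite mxE eqxx andbT addr0; case: eqP; rewrite ?mulr1 // mulr0 mul0r.
Qed.

Definition tens_act b A x : tens F n m N := \sum_a site_act b a A x.

Lemma tens_actE b A x J : tens_act b A x J =
  \sum_a \sum_i (-1) ^+ (b && parity_before (odd_at J) a) * A (J a) i * x (upd J a i).
Proof. by rewrite sum_ffunE; apply: eq_bigr => a _; rewrite site_actE. Qed.

Fact tens_act_is_bilinear b : bilinear_map (tens_act b).
Proof.
split=> [x|A] k u v /=; rewrite /tens_act scaler_sumr -big_split; apply: eq_bigr => a _.
  exact: linearPl.
exact: linearPr.
Qed.
HB.instance Definition _ b :=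
  bilinear_isBilinear.Build F 'M[F]_(n + m) (tens F n m N) (tens F n m N) _ _ (tens_act b)
    (tens_act_is_bilinear b).

HB.instance Definition _ b A :=
  GRing.isLinear.Build F (tens F n m N) (tens F n m N) _ (tens_act b A) (linearPr (tens_act b) A).

Lemma permact_tens_act b A s x : homogeneous b A ->
  permact s (tens_act b A x) = tens_act b A (permact s x).
Proof.
move=> hA; rewrite linear_sum [RHS](reindex_inj (@perm_inj _ s)) /=.
by apply: eq_bigr => a _; rewrite permact_site_act.
Qed.

Lemma tens_act_supercomm b b' A B x : homogeneous b A -> homogeneous b' B ->
  tens_act b A (tens_act b' B x) - (-1) ^+ (b && b') *: tens_act b' B (tens_act b A x) =
  tens_act (b (+) b') (supercomm b b' A B) x.
Proof.
move=> hA hB.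
have act_act (c c' : bool) C D :
    tens_act c C (tens_act c' D x) = \sum_a \sum_d site_act c a C (site_act c' d D x).
  by apply: eq_bigr => a _; rewrite linear_sumr.
rewrite !act_act [X in _ - _ *: X]exchange_big scaler_sumr -sumrB; apply: eq_bigr => a _.
rewrite scaler_sumr -sumrB (bigD1 a) //= big1 => [|c neq_ca]; last first.
  by rewrite (site_act_comm _ hA hB) ?subrr // eq_sym.
by rewrite addr0 !site_act_mul (addbC b') -linearZl_LR -linearBl.
Qed.

Lemma tens_act_basis b A I :
  tens_act b A (basis F I) =
  \sum_a \sum_r ((-1) ^+ (b && parity_before (odd_at I) a) * A r (I a)) *: basis F (upd I a r).
Proof.
apply/ffunP => J; rewrite tens_actE sum_ffunE; apply: eq_bigr => a _; rewrite sum_ffunE.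
rewrite (bigD1 (I a)) //= [RHS](bigD1 (J a)) //= !big1 => [|r neq_r|i neq_i].
- rewrite !addr0 ffun_scaleE !basisE.
  have -> : (upd J a (I a) == I) = (J == upd I a (J a)).
    by apply/eqP/eqP => [eI|eJ]; [rewrite -eI | rewrite eJ]; rewrite upd_upd upd_id.
  have [eJ|_] := eqVneq J (upd I a (J a)); last by rewrite !mulr0.
  by rewrite {1}eJ odd_at_upd parity_before_toggle ltnn addbF.
- rewrite ffun_scaleE basisE; case: eqP => [eJ|_]; last by rewrite mulr0.
  by rewrite eJ upd_at eqxx in neq_r.
rewrite basisE; case: eqP => [eI|_]; last by rewrite mulr0.
by rewrite -eI upd_at eqxx in neq_i.
Qed.

Definition grading b x : tens F n m N :=
  [ffun I => (-1) ^+ (b && parity (odd_at I)) * x I].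

Lemma gradingE b x I : grading b x I = (-1) ^+ (b && parity (odd_at I)) * x I.
Proof. by rewrite ffunE. Qed.

Lemma grading_is_linear b : linear (grading b).
Proof.
move=> k x y; apply/ffunP => J.
by rewrite ffun_addE ffun_scaleE !gradingE ffun_addE ffun_scaleE mulrDr mulrCA.
Qed.
HB.instance Definition _ b :=
  GRing.isLinear.Build F (tens F n m N) (tens F n m N) _ (grading b) (grading_is_linear b).

Lemma permact_grading b s x : permact s (grading b x) = grading b (permact s x).
Proof.
apply/ffunP => J.
by rewrite !(permactE, gradingE) mulrCA odd_at_pactV parity_pull.
Qed.

Lemma grading_basis b I :
  grading b (basis F I) = (-1) ^+ (b && parity (odd_at I)) *: basis F I.
Proof.
apply/ffunP => J; rewrite ffun_scaleE gradingE !ffunE.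
by case: eqP => [->//|_]; rewrite !mulr0.
Qed.

Lemma gradingD b b' x : grading b (grading b' x) = grading (b (+) b') x.
Proof. by apply/ffunP => J; rewrite !gradingE mulrA -signr_addb andb_addl. Qed.

Lemma grading_tens_act b b' A x : homogeneous b' A ->
  grading b (tens_act b' A x) = (-1) ^+ (b && b') *: tens_act b' A (grading b x).
Proof.
move=> hA; apply/ffunP => J; rewrite ffun_scaleE gradingE !tens_actE !mulr_sumr.
apply: eq_bigr => a _; rewrite !mulr_sumr; apply: eq_bigr => i _.
have [->|Aji] := eqVneq (A (J a) i) 0; first by rewrite !(mulr0, mul0r).
rewrite gradingE odd_at_upd parity_toggle (homogeneous_entry hA Aji).
rewrite !mulrA; congr (_ * _); rewrite [RHS]mulrAC -!signr_addb.
congr (_ ^+ nat_of_bool _ * _).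
by case: b b' (parity _) (parity_before _ _) {hA} => [] [] [] [].
Qed.

End Tensors.

Section Concatenation.
Variables n m p q : nat.
Implicit Types (I : mi n m p) (L : mi n m q) (J : mi n m (p + q)).

Definition leftmi J : mi n m p := [ffun a => J (lshift q a)].
Definition rightmi J : mi n m q := [ffun a => J (rshift p a)].

Lemma catmiL I L a : catmi I L (lshift q a) = I a.
Proof. by rewrite ffunE (unsplitK (inl a)). Qed.

Lemma catmiR I L a : catmi I L (rshift p a) = L a.
Proof. by rewrite ffunE (unsplitK (inr a)). Qed.

Lemma leftmi_cat I L : leftmi (catmi I L) = I.
Proof. by apply/ffunP => a; rewrite ffunE catmiL. Qed.

Lemma rightmi_cat I L : rightmi (catmi I L) = L.
Proof. by apply/ffunP => a; rewrite ffunE catmiR. Qed.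

Lemma catmi_split J : catmi (leftmi J) (rightmi J) = J.
Proof.
by apply/ffunP => k; case: (split_ordP k) => j ->; rewrite ?catmiL ?catmiR ffunE.
Qed.

Lemma upd_catL I L a r : upd (catmi I L) (lshift q a) r = catmi (upd I a r) L.
Proof.
apply/ffunP => k; case: (split_ordP k) => j ->; rewrite ?catmiL ?catmiR ffunE.
  by rewrite eq_lshift catmiL ffunE.
by rewrite eq_rlshift catmiR.
Qed.

Lemma upd_catR I L a r : upd (catmi I L) (rshift p a) r = catmi I (upd L a r).
Proof.
apply/ffunP => k; case: (split_ordP k) => j ->; rewrite ?catmiL ?catmiR ffunE.
  by rewrite eq_lrshift catmiL.
by rewrite eq_rshift catmiR ffunE.
Qed.

Lemma parity_cat I L : parity (odd_at (catmi I L)) = parity (odd_at I) (+) parity (odd_at L).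
Proof.
rewrite /parity big_split_ord /=.
congr (_ (+) _); apply: eq_bigr => a _; rewrite !ffunE.
  by rewrite (unsplitK (inl a)).
by rewrite (unsplitK (inr a)).
Qed.

Lemma parity_before_catL I L a :
  parity_before (odd_at (catmi I L)) (lshift q a) = parity_before (odd_at I) a.
Proof.
rewrite /parity_before big_split_ord /= [X in _ (+) X]big1 ?addbF => [|c].
  by apply: eq_bigr => c _; rewrite !ffunE (unsplitK (inl c)).
by rewrite ltnNge (leq_trans (ltnW (ltn_ord a)) (leq_addr _ _)).
Qed.

Lemma parity_before_catR I L a :
  parity_before (odd_at (catmi I L)) (rshift p a) =
  parity (odd_at I) (+) parity_before (odd_at L) a.
Proof.
rewrite /parity_before big_split_ord /=; congr (_ (+) _); apply: eq_big => [c|c _].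
- by rewrite (leq_trans (ltn_ord c) (leq_addr _ _)).
- by rewrite !ffunE (unsplitK (inl c)).
- by rewrite ltn_add2l.
by rewrite !ffunE (unsplitK (inr c)).
Qed.

End Concatenation.

Section ConcatenatedTensors.
Variables (F : fieldType) (n m p q : nat).
Implicit Types (x : tens F n m p) (y : tens F n m q) (I : mi n m p) (L : mi n m q).

Definition catt x y : tens F n m (p + q) := [ffun J => x (leftmi J) * y (rightmi J)].

Lemma cattE x y I L : catt x y (catmi I L) = x I * y L.
Proof. by rewrite ffunE leftmi_cat rightmi_cat. Qed.

Fact catt_is_bilinear : bilinear_map catt.
Proof.
split=> [y|x] k u v; apply/ffunP => J; rewrite ffun_addE ffun_scaleE !ffunE.
  by rewrite mulrDl -mulrA.
by rewrite mulrDr [_ * (_ *: _)]mulrCA.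
Qed.
HB.instance Definition _ :=
  bilinear_isBilinear.Build F (tens F n m p) (tens F n m q) (tens F n m (p + q)) _ _ catt
    catt_is_bilinear.

Lemma catt_basis I L : catt (basis F I) (basis F L) = basis F (catmi I L).
Proof.
apply/ffunP => J; rewrite -[J]catmi_split cattE !basisE -natrM mulnb; congr (nat_of_bool _)%:R.
apply/andP/eqP => [[/eqP-> /eqP->] //|eq_cat].
split; apply/eqP; first by rewrite -(leftmi_cat I L) -eq_cat leftmi_cat.
by rewrite -(rightmi_cat I L) -eq_cat rightmi_cat.
Qed.

Lemma grading_catt b x y : grading b (catt x y) = catt (grading b x) (grading b y).
Proof.
apply/ffunP => J; rewrite -[J]catmi_split gradingE !cattE !gradingE parity_cat.
by rewrite andb_addr signr_addb mulrACA.
Qed.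

Lemma tens_act_catt b (A : 'M[F]_(n + m)) x y :
  tens_act b A (catt x y) = catt (tens_act b A x) y + catt (grading b x) (tens_act b A y).
Proof.
apply/ffunP => J; rewrite -[J]catmi_split ffun_addE !cattE !tens_actE gradingE big_split_ord /=.
rewrite mulr_suml mulr_sumr; congr (_ + _); apply: eq_bigr => a _.
  rewrite mulr_suml; apply: eq_bigr => i _.
  by rewrite upd_catL cattE parity_before_catL catmiL mulrA.
rewrite mulr_sumr; apply: eq_bigr => i _.
rewrite upd_catR cattE parity_before_catR catmiR andb_addr signr_addb.
by rewrite !mulrA -!(mulrAC _ (x _)).
Qed.

End ConcatenatedTensors.

(** * Mixed tensors *)

Section MixedTensors.
Variables (F : fieldType) (n m p q : nat).
Implicit Types (b : bool) (X Y : 'M[F]_(n + m)) (x : tens F n m p) (y : tens F n m q).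
Implicit Types (I : mi n m p) (K : mi n m q) (w : mtens F n m p q).

Local Notation act b X := (@mact F n m b X p q).

Fact tprod_is_bilinear : bilinear_map (@tprod F n m p q).
Proof.
split=> [y|x] k u v; apply/ffunP => J; rewrite ffun_addE ffun_scaleE !ffunE.
  by rewrite mulrDl -mulrA.
by rewrite mulrDr [_ * (_ *: _)]mulrCA.
Qed.
HB.instance Definition _ :=
  bilinear_isBilinear.Build F (tens F n m p) (tens F n m q) (mtens F n m p q) _ _
    (@tprod F n m p q) tprod_is_bilinear.

Lemma tprodE x y I K : tprod x y (I, K) = x I * y K.
Proof. by rewrite ffunE. Qed.

Lemma mbasisE I K : mbasis F I K = tprod (basis F I) (basis F K).
Proof. by apply/ffunP => -[J L]; rewrite tprodE !basisE ffunE -natrM mulnb. Qed.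

Lemma mtens_sum_basis w : w = \sum_IK w IK *: tprod (basis F IK.1) (basis F IK.2).
Proof.
apply/ffunP => JL; rewrite sum_ffunE (bigD1 JL) //= big1 => [|IK neIK].
  by rewrite ffun_scaleE ffunE !basisE !eqxx !mulr1 addr0.
rewrite ffun_scaleE ffunE !basisE -natrM mulnb -xpair_eqE -!surjective_pairing.
by rewrite eq_sym (negPf neIK) mulr0.
Qed.

Lemma mact_is_linear b X : linear (@mact F n m b X p q).
Proof.
move=> k w1 w2; rewrite /mact scaler_sumr -big_split; apply: eq_bigr => IK _.
by rewrite ffun_addE ffun_scaleE scalerDl scalerA.
Qed.
HB.instance Definition _ b X :=
  GRing.isLinear.Build F (mtens F n m p q) (mtens F n m p q) _ (@mact F n m b X p q)
    (mact_is_linear b X).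

Definition lslice K w : tens F n m p := [ffun I => w (I, K)].
Definition rslice I w : tens F n m q := [ffun K => w (I, K)].

Lemma lslice_is_linear K : linear (lslice K).
Proof. by move=> k x y; apply/ffunP => J; rewrite !ffunE. Qed.
HB.instance Definition _ K :=
  GRing.isLinear.Build F (mtens F n m p q) (tens F n m p) _ (lslice K) (lslice_is_linear K).

Lemma rslice_is_linear I : linear (rslice I).
Proof. by move=> k x y; apply/ffunP => J; rewrite !ffunE. Qed.
HB.instance Definition _ I :=
  GRing.isLinear.Build F (mtens F n m p q) (tens F n m q) _ (rslice I) (rslice_is_linear I).

Lemma lslice_tprod K x y : lslice K (tprod x y) = y K *: x.
Proof. by apply/ffunP => I; rewrite ffun_scaleE !ffunE mulrC. Qed.

Lemma rslice_tprod I x y : rslice I (tprod x y) = x I *: y.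
Proof. by apply/ffunP => K; rewrite ffun_scaleE !ffunE. Qed.

Lemma mact_tprod_basis b X I K (x := basis F I) (y := basis F K) :
  mact b X (tprod x y) =
  tprod (tens_act b X x) y + tprod (grading b x) (tens_act b (dualmx b X) y).
Proof.
rewrite /mact (bigD1 (I, K)) //= big1 => [|[J L] /= neJL]; last first.
  by rewrite tprodE !basisE -natrM mulnb -xpair_eqE (negPf neJL) scale0r.
rewrite tprodE !basisE !eqxx mulr1 scale1r addr0 /actb !tens_act_basis grading_basis.
rewrite linear_sumlz linearZl_LR linear_sumr /= scaler_sumr.
congr (_ + _); apply: eq_bigr => a _.
  rewrite linear_sumlz; apply: eq_bigr => r _.
  by rewrite linearZl_LR mbasisE signr_parity_before.
rewrite linear_sumr /= scaler_sumr; apply: eq_bigr => r _.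
rewrite linearZr_LR /= scalerA mbasisE mxE mulnDr exprD signr_parity signr_parity_before.
by rewrite mulnb !mulrA.
Qed.

Lemma mact_tprod b X x y :
  mact b X (tprod x y) =
  tprod (tens_act b X x) y + tprod (grading b x) (tens_act b (dualmx b X) y).
Proof.
rewrite (tens_sum_basis y) [tens_act _ _ (\sum_I _)]linear_sumr !linear_sumr linear_sum.
rewrite -big_split; apply: eq_bigr => K _ /=.
rewrite !linearZr_LR linearZ -scalerDr; congr (_ *: _) => /=.
rewrite (tens_sum_basis x) [tens_act _ _ (\sum_I _)]linear_sumr linear_sum !linear_sumlz linear_sum.
rewrite -big_split; apply: eq_bigr => I _ /=.
by rewrite linearZr_LR !linearZ /= !linearZl_LR linearZ /= -scalerDr mact_tprod_basis.
Qed.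

Lemma eq_linear_tprod (V : lmodType F) (f g : {linear mtens F n m p q -> V}) :
  (forall x y, f (tprod x y) = g (tprod x y)) -> f =1 g.
Proof.
move=> fg w; rewrite (mtens_sum_basis w) !linear_sum; apply: eq_bigr => IK _.
by rewrite !linearZ /= fg.
Qed.

Lemma mactDl b X Y w : mact b (X + Y) w = mact b X w + mact b Y w.
Proof.
suff: act b (X + Y) =1 act b X \+ act b Y by apply.
apply: eq_linear_tprod => x y /=.
by rewrite !mact_tprod linearD !linearDl linearDr addrACA.
Qed.

Lemma mactE b X w I K :
  mact b X w (I, K) =
  tens_act b X (lslice K w) I
  + (-1) ^+ (b && parity (odd_at I)) * tens_act b (dualmx b X) (rslice I w) K.
Proof.
rewrite {1}(mtens_sum_basis w) {2 3}(mtens_sum_basis w) !linear_sum !sum_ffunE.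
rewrite mulr_sumr -big_split; apply: eq_bigr => JL _ /=.
rewrite !linearZ /= !ffun_scaleE mulrCA -mulrDr; congr (_ * _).
rewrite mact_tprod ffun_addE !tprodE gradingE lslice_tprod rslice_tprod !linearZ /=.
by rewrite !ffun_scaleE mulrC !mulrA.
Qed.

Lemma mact_supercomm b b' X Y w : homogeneous b X -> homogeneous b' Y ->
  mact b X (mact b' Y w) - (-1) ^+ (b && b') *: mact b' Y (mact b X w) =
  mact (b (+) b') (supercomm b b' X Y) w.
Proof.
move=> hX hY; set e := (-1) ^+ _.
suff: act b X \o act b' Y \- e \*: (act b' Y \o act b X) =1
    act (b (+) b') (supercomm b b' X Y) by apply.
apply: eq_linear_tprod => x y /=.
have cancel_cross_terms (V : zmodType) (u v r s t z : V) :
    u + v + (r + s) - (t + r + (v + z)) = u - t + (s - z).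
  by rewrite (addrC r) addrACA (addrC t) (addrACA r) (addrC r) addrKA opprD addrACA.
have e_sqr : e * e = 1 by rewrite -signr_addb addbb.
rewrite !mact_tprod !(linearD (act _ _)) /= !mact_tprod !gradingD (addbC b' b).
rewrite !(grading_tens_act _ _ hX) !(grading_tens_act _ _ hY) (andbC b' b) -/e.
rewrite -(tens_act_supercomm _ hX hY) -dualmx_supercomm //.
rewrite -(tens_act_supercomm _ (homogeneous_dualmx hX) (homogeneous_dualmx hY)) -/e.
rewrite !(linearBl, linearBr, linearZl_LR, linearZr_LR) /= !scalerDr !scalerA e_sqr !scale1r.
exact: cancel_cross_terms.
Qed.

End MixedTensors.

(** * Young symmetrizers *)

Section Symmetrizers.
Variables (F : fieldType) (n m N : nat).
Implicit Types (x y : tens F n m N) (I J : mi n m N) (row col : nat -> nat).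
Implicit Types (b : bool) (A : 'M[F]_(n + m)) (s t : 'S_N) (k l : 'I_N) (chi : 'S_N -> F).

Fact Rgrp_group_set row : group_set (Rgrp N row).
Proof.
apply/group_setP; split=> [|s t]; first by rewrite inE; apply/forallP => k; rewrite perm1.
rewrite !inE => /forallP rs /forallP rt; apply/forallP => k.
by rewrite permM (eqP (rt _)).
Qed.
Canonical Rgrp_group row : {group 'S_N} := Group (Rgrp_group_set row).

Lemma tperm_Rgrp row k l : row k = row l -> tperm k l \in Rgrp N row.
Proof.
by move=> eq_row; rewrite inE; apply/forallP => c; case: tpermP => [->|->|]; rewrite ?eq_row.
Qed.

Definition char_sum (chi : 'S_N -> F) row x : tens F n m N :=
  \sum_(s in Rgrp N row) chi s *: permact s x.
Definition symmetrizer := char_sum (fun=> 1).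
Definition antisymmetrizer := char_sum (@sgnF F N).

Lemma char_sum_is_linear chi row : linear (char_sum chi row).
Proof.
move=> k x y; rewrite /char_sum scaler_sumr -big_split /=.
by apply: eq_bigr => s _; rewrite linearP scalerDr !scalerA mulrC.
Qed.
HB.instance Definition _ chi row :=
  GRing.isLinear.Build F (tens F n m N) (tens F n m N) _ (char_sum chi row)
    (char_sum_is_linear chi row).

HB.instance Definition _ row := GRing.Linear.copy (symmetrizer row) (char_sum (fun=> 1) row).
HB.instance Definition _ col :=
  GRing.Linear.copy (antisymmetrizer col) (char_sum (@sgnF F N) col).

Lemma symmetrizerE row x : symmetrizer row x = \sum_(s in Rgrp N row) permact s x.
Proof. by apply: eq_bigr => s _; rewrite scale1r. Qed.

Lemma ysymE row col x : ysym row col x = symmetrizer row (antisymmetrizer col x).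
Proof.
rewrite [RHS]linear_sum; apply: eq_bigr => t _.
by rewrite linearZ /= -/symmetrizer symmetrizerE scaler_sumr.
Qed.

Lemma ysymtE row col x : ysymt row col x = antisymmetrizer col (symmetrizer row x).
Proof.
by apply: eq_bigr => t _; rewrite symmetrizerE (linear_sum (permact t)) /= scaler_sumr.
Qed.

Lemma ysym_is_linear row col : linear (@ysym F n m N row col).
Proof. by move=> k x y; rewrite !ysymE !linearP. Qed.
HB.instance Definition _ row col :=
  GRing.isLinear.Build F (tens F n m N) (tens F n m N) _ (@ysym F n m N row col)
    (ysym_is_linear row col).

Lemma ysymt_is_linear row col : linear (@ysymt F n m N row col).
Proof. by move=> k x y; rewrite !ysymtE !linearP. Qed.
HB.instance Definition _ row col :=
  GRing.isLinear.Build F (tens F n m N) (tens F n m N) _ (@ysymt F n m N row col)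
    (ysymt_is_linear row col).

Section EquivariantMaps.
Variable f : {linear tens F n m N -> tens F n m N}.
Hypothesis f_permact : forall s x, f (permact s x) = permact s (f x).

Lemma char_sum_comm chi row x : f (char_sum chi row x) = char_sum chi row (f x).
Proof. by rewrite linear_sum; apply: eq_bigr => s _; rewrite linearZ /= f_permact. Qed.

Lemma ysym_comm row col x : f (ysym row col x) = ysym row col (f x).
Proof. by rewrite !ysymE !char_sum_comm. Qed.

Lemma ysymt_comm row col x : f (ysymt row col x) = ysymt row col (f x).
Proof. by rewrite !ysymtE !char_sum_comm. Qed.

End EquivariantMaps.

Lemma tens_act_ysym b A row col x : homogeneous b A ->
  tens_act b A (ysym row col x) = ysym row col (tens_act b A x).
Proof. by move=> hA; apply: ysym_comm => s y; rewrite permact_tens_act. Qed.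

Lemma tens_act_ysymt b A row col x : homogeneous b A ->
  tens_act b A (ysymt row col x) = ysymt row col (tens_act b A x).
Proof. by move=> hA; apply: ysymt_comm => s y; rewrite permact_tens_act. Qed.

Lemma grading_ysym b row col x : grading b (ysym row col x) = ysym row col (grading b x).
Proof. by apply: ysym_comm => s y; rewrite permact_grading. Qed.

Definition row_symmetric row x := forall s, s \in Rgrp N row -> permact s x = x.

Lemma row_symmetricZ row (k : F) x : row_symmetric row x -> row_symmetric row (k *: x).
Proof. by move=> x_sym s rs; rewrite linearZ /= x_sym. Qed.

Lemma row_symmetricD row x y :
  row_symmetric row x -> row_symmetric row y -> row_symmetric row (x + y).
Proof. by move=> x_sym y_sym s rs; rewrite linearD /= x_sym ?y_sym. Qed.

Lemma row_symmetric_sum row (T : finType) (x : T -> tens F n m N) :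
  (forall i, row_symmetric row (x i)) -> row_symmetric row (\sum_i x i).
Proof. by move=> x_sym s rs; rewrite linear_sum; apply: eq_bigr => i _; apply: x_sym. Qed.

Lemma symmetrizer_row_symmetric row x : row_symmetric row (symmetrizer row x).
Proof.
move=> s rs; rewrite !symmetrizerE linear_sum [RHS](reindex_inj (mulIg s)) /=.
by apply: eq_big => [t|t _]; rewrite ?groupMr // permactM.
Qed.

Lemma ysym_row_symmetric row col x : row_symmetric row (ysym row col x).
Proof. by rewrite ysymE; apply: symmetrizer_row_symmetric. Qed.

Lemma site_act_row_symmetric b A row x J k l : homogeneous b A -> row_symmetric row x ->
  row k = row l -> J k = J l -> ~~ par (J k) -> site_act b k A x J = site_act b l A x J.
Proof.
move=> hA x_sym eq_row eqJ evJ; have [->//|neq_kl] := eqVneq k l.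
rewrite -{1}(x_sym (tperm l k)) ?tperm_Rgrp // -{1}(tpermL l k) -permact_site_act // permactE.
have -> : pact (tperm l k)^-1%g J = J.
  by apply/ffunP => c; rewrite pactVE; case: tpermP => [->|->|].
by rewrite tpermV tpermC inversion_parity_tperm ?odd_atE -?eqJ // (negPf evJ) expr0 mul1r.
Qed.

End Symmetrizers.

Lemma eq_oppr0 (F : fieldType) (V : lmodType F) (v : V) :
  2%:R != 0 :> F -> v = - v -> v = 0.
Proof.
move=> two_neq0 vN; have /eqP : 2%:R *: v = 0 by rewrite scaler_nat mulr2n {2}vN subrr.
by rewrite scaler_eq0 (negPf two_neq0) => /eqP.
Qed.

Section RepeatedLabels.
Variables (F : fieldType) (n m N : nat).
Hypothesis two_neq0 : 2%:R != 0 :> F.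
Implicit Types (I : mi n m N) (row col : nat -> nat) (s t : 'S_N) (k l : 'I_N).

Lemma char_sum_basis0 (chi : 'S_N -> F) row I k l : k != l -> row k = row l -> I k = I l ->
    (forall t, chi (tperm k l * t)%g = - (-1) ^+ par (I k) * chi t) ->
  char_sum chi row (basis F I) = 0.
Proof.
move=> neq_kl eq_row eq_I chi_tperm; apply: (eq_oppr0 two_neq0).
rewrite {1}/char_sum (reindex_inj (mulgI (tperm k l))) /= -sumrN.
apply: eq_big => [t|t _]; first by rewrite groupMl // tperm_Rgrp.
rewrite -permactM permact_tperm_basis // linearZ scalerA chi_tperm /=.
by rewrite mulrAC mulNr -signr_addb addbb mulN1r scaleNr.
Qed.

Lemma antisymmetrizer_basis0 col I k l : k != l -> col k = col l ->
  I k = I l -> ~~ par (I k) -> antisymmetrizer col (basis F I) = 0.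
Proof.
move=> neq_kl eq_col eq_I evI; apply: (char_sum_basis0 neq_kl) => // t.
by rewrite /sgnF odd_mul_tperm neq_kl (negPf evI) signrN mulN1r.
Qed.

Lemma symmetrizer_basis0 row I k l : k != l -> row k = row l ->
  I k = I l -> par (I k) -> symmetrizer row (basis F I) = 0.
Proof.
move=> neq_kl eq_row eq_I odI; apply: (char_sum_basis0 neq_kl) => // t.
by rewrite odI expr1 opprK mulr1.
Qed.

Lemma card_even_labels : #|[set i : 'I_(n + m) | ~~ par i]| = n.
Proof.
rewrite -sum1dep_card big_split_ord /= [X in (_ + X)%N]big1 => [|j].
  rewrite (eq_bigl xpredT) ?sum1_card ?card_ord ?addn0 // => i.
  by rewrite /par /= -ltnNge ltn_ord.
by rewrite /par /= leq_addr.
Qed.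

Definition even_sites I : {set 'I_N} := [set k | ~~ par (I k)].

Lemma card_even_sites_pact s I : #|even_sites (pact s I)| = #|even_sites I|.
Proof.
rewrite -(card_imset (even_sites I) (@perm_inj _ s)); apply: eq_card => k.
by rewrite -{2}(permKV s k) mem_imset ?inE ?ffunE //; apply: perm_inj.
Qed.

(* A column of the tableau can hold each of the [n] even labels at most once. *)
Lemma antisymmetrizer_basis_crowded0 col width I : (forall k : 'I_N, col k < width)%N ->
  (width * n < #|even_sites I|)%N -> antisymmetrizer col (basis F I) = 0.
Proof.
move=> col_lt crowded; pose f k := (Ordinal (col_lt k), I k).
have: ~~ dinjectiveb f (mem (even_sites I)).
  apply: contraL crowded => /dinjectiveP f_inj; rewrite -leqNgt -(card_in_imset f_inj).
  apply: (@leq_trans #|setX [set: 'I_width] [set i : 'I_(n + m) | ~~ par i]|).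
    by apply/subset_leq_card/subsetP => _ /imsetP[k + ->]; rewrite !inE.
  by rewrite cardsX cardsT card_ord card_even_labels.
case/dinjectivePn => k evk [l /andP[neq_lk _] [eq_col eq_I]]; rewrite inE in evk.
by apply: (antisymmetrizer_basis0 (k := k) (l := l)); rewrite // eq_sym.
Qed.

Lemma ysymt_basis_crowded0 row col width I : (forall k : 'I_N, col k < width)%N ->
  (width * n < #|even_sites I|)%N -> ysymt row col (basis F I) = 0.
Proof.
move=> col_lt crowded; rewrite ysymtE symmetrizerE linear_sum big1 // => s _.
rewrite permact_basis linearZ /=.
by rewrite (antisymmetrizer_basis_crowded0 col_lt) ?scaler0 // card_even_sites_pact.
Qed.

End RepeatedLabels.

(** * Inserting the canonical tensor *)

Section Theta.
Variables (F : fieldType) (n m N : nat).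
Implicit Types (L : mi n m N) (X : 'M[F]_(n + m)) (b : bool).

Lemma alphaE (R : pzRingType) L :
  (-1) ^+ alpha L = (-1) ^+ parity_pairs (fun _ _ => true) (odd_at L) :> R.
Proof.
rewrite /alpha pair_big_dep -signr_sum; congr (_ ^+ _).
by apply: eq_bigr => ac _; rewrite !odd_atE mulnb.
Qed.

Lemma alpha_upd (R : pzRingType) L a r :
  (-1) ^+ alpha (upd L a r) =
  (-1) ^+ alpha L *
  (-1) ^+ ((par (L a) (+) par r) && (parity (odd_at L) (+) par (L a))) :> R.
Proof.
rewrite !alphaE odd_at_upd parity_pairs_toggle // -signr_addb.
by rewrite [parity _](bigD1 a) //= odd_atE addbAC addbb.
Qed.

Lemma alpha_dualmx_upd b X L a r (L' := upd L a r) : homogeneous b X ->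
  (-1) ^+ alpha L' * ((-1) ^+ (b && parity (odd_at L')) *
    ((-1) ^+ (b && parity_before (odd_at L') a) * dualmx b X (L a) r)) =
  - ((-1) ^+ alpha L * ((-1) ^+ (b && parity_before (odd_at L) a) * X r (L a))).
Proof.
move=> hX; rewrite mxE alpha_upd odd_at_upd parity_toggle parity_before_toggle ltnn addbF.
have [->|Xra] := eqVneq (X r (L a)) 0; first by rewrite !(mulr0, oppr0).
have := homogeneous_entry hX Xra; rewrite addbC => /[dup] parb ->.
rewrite !mulrN -[_ * _ * (_ * _)]mulrA; congr (- (_ * _)).
rewrite !mulrA; congr (_ * _); rewrite [LHS]mulrAC -!signr_addb.
congr (_ ^+ nat_of_bool _); rewrite -parb.
by case: (par (L a)) (par r) (parity _) (parity_before _ _) => [] [] [] [].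
Qed.

(* For [G := tprod] this says that [X] kills [theta]. *)
Lemma theta_invariant (V : lmodType F)
    (G : {bilinear tens F n m N -> tens F n m N -> V}) b X : homogeneous b X ->
  \sum_L (-1) ^+ alpha L *:
    (G (tens_act b X (basis F L)) (basis F L)
     + G (grading b (basis F L)) (tens_act b (dualmx b X) (basis F L))) = 0.
Proof.
move=> hX; pose v L := basis F L.
have expandl L : G (tens_act b X (v L)) (v L) =
    \sum_a \sum_r ((-1) ^+ (b && parity_before (odd_at L) a) * X r (L a))
      *: G (v (upd L a r)) (v L).
  rewrite tens_act_basis linear_sumlz; apply: eq_bigr => a _; rewrite linear_sumlz.
  by apply: eq_bigr => r _; rewrite linearZl_LR.
have expandr L : G (grading b (v L)) (tens_act b (dualmx b X) (v L)) =
    \sum_a \sum_r ((-1) ^+ (b && parity (odd_at L)) *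
      ((-1) ^+ (b && parity_before (odd_at L) a) * dualmx b X r (L a)))
      *: G (v L) (v (upd L a r)).
  rewrite grading_basis tens_act_basis linearZl_LR linear_sumr /= scaler_sumr.
  apply: eq_bigr => a _.
  rewrite linear_sumr scaler_sumr; apply: eq_bigr => r _.
  by rewrite linearZr_LR /= scalerA.
under eq_bigr => L _ do rewrite scalerDr expandl expandr !scaler_sumr.
rewrite big_split /= exchange_big [X in _ + X]exchange_big /= -big_split /=.
apply: big1 => a _.
under eq_bigr => L _ do rewrite scaler_sumr.
under [X in _ + X]eq_bigr => L _ do rewrite scaler_sumr.
rewrite [X in _ + X](sum_upd_swap a) -big_split big1 //= => L _.
rewrite -big_split big1 //= => r _.
rewrite upd_upd upd_id upd_at !scalerA -scalerDl alpha_dualmx_upd //.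
by rewrite subrr scale0r.
Qed.

End Theta.

Section InsertTheta.
Variables (F : fieldType) (n m p N q : nat) (rs cs rt ct : nat -> nat).
Implicit Types (x : tens F n m p) (u v : tens F n m N) (y : tens F n m q).
Implicit Types (b : bool) (X : 'M[F]_(n + m)).

(* [(e_s x e~_t) (x (x) u (x) v (x) y)], where [e_s] acts on the [V]-factors [x (x) u] and
   [e~_t] on the [V*]-factors [v (x) y]. *)
Definition embed x y u v : mtens F n m (p + N) (N + q) :=
  tprod (ysym rs cs (catt x u)) (ysymt rt ct (catt v y)).

Fact embed_is_bilinear x y : bilinear_map (embed x y).
Proof.
split=> [v|u] k u1 u2 /=; rewrite /embed.
  by rewrite linearPr linearP linearPl.
by rewrite linearPl linearP linearPr.
Qed.
HB.instance Definition _ x y :=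
  bilinear_isBilinear.Build F (tens F n m N) (tens F n m N) (mtens F n m (p + N) (N + q)) _ _
    (embed x y) (embed_is_bilinear x y).

Lemma mact_embed b X x y u v : homogeneous b X ->
  mact b X (embed x y u v) =
  embed (tens_act b X x) y u v + embed (grading b x) y (tens_act b X u) v
  + (embed (grading b x) y (grading b u) (tens_act b (dualmx b X) v)
     + embed (grading b x) (tens_act b (dualmx b X) y) (grading b u) (grading b v)).
Proof.
move=> hX; have hX' := homogeneous_dualmx hX.
rewrite /embed mact_tprod (tens_act_ysym _ _ _ hX) (tens_act_ysymt _ _ _ hX') grading_ysym.
rewrite grading_catt 2!tens_act_catt (linearD (ysym _ _)) (linearD (ysymt _ _)).
by rewrite linearDl linearDr.
Qed.

(* [(e_s x e~_t) (x (x) theta (x) y)] *)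
Definition insert_theta x y : mtens F n m (p + N) (N + q) :=
  \sum_(L : mi n m N) (-1) ^+ alpha L *: embed x y (basis F L) (basis F L).

Fact insert_theta_is_bilinear : bilinear_map insert_theta.
Proof.
split=> [y|x] k u v /=; rewrite /insert_theta scaler_sumr -big_split; apply: eq_bigr => L _ /=.
  by rewrite /embed linearPl linearP linearPl scalerDr !scalerA mulrC.
by rewrite /embed linearPr linearP linearPr scalerDr !scalerA mulrC.
Qed.
HB.instance Definition _ :=
  bilinear_isBilinear.Build F (tens F n m p) (tens F n m q) (mtens F n m (p + N) (N + q)) _ _
    insert_theta insert_theta_is_bilinear.

Lemma mact_insert_theta b X x y : homogeneous b X ->
  mact b X (insert_theta x y) =
  insert_theta (tens_act b X x) y + insert_theta (grading b x) (tens_act b (dualmx b X) y).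
Proof.
move=> hX; rewrite [LHS]linear_sum -[RHS]addr0.
rewrite -[X in _ = _ + X](theta_invariant (embed (grading b x) y) hX) -!big_split /=.
apply: eq_bigr => L _ /=; rewrite linearZ -!scalerDr; congr (_ *: _) => /=.
have regroup (V : zmodType) (r s t u : V) : r + s + (t + u) = r + u + (s + t).
  by rewrite (addrC t) addrACA.
rewrite (mact_embed _ _ _ _ hX) regroup grading_basis linearZl_LR linearZr_LR /=.
by rewrite scalerA -signr_addb addbb scale1r.
Qed.

Lemma lslice_insert_theta_row_symmetric x y K : row_symmetric rs (lslice K (insert_theta x y)).
Proof.
rewrite linear_sum; apply: row_symmetric_sum => L; rewrite linearZ.
by apply: row_symmetricZ; rewrite /embed /= lslice_tprod; apply/row_symmetricZ/ysym_row_symmetric.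
Qed.

End InsertTheta.

(** * Vectors killed by the raising operators *)

Section Raising.
Variables (F : fieldType) (n m : nat).
Implicit Types (X Y : 'M[F]_(n + m)).

Definition raising Y : Prop := forall i j, Y i j != 0 -> ~~ par i && par j.
Definition lowering X : Prop := forall i j, X i j != 0 -> par i && ~~ par j.

Lemma raising_homogeneous Y : raising Y -> homogeneous true Y.
Proof.
move=> rY i j; apply: contraNeq => /rY /andP[].
by case: (par i) (par j) => [] [].
Qed.

Lemma lowering_homogeneous X : lowering X -> homogeneous true X.
Proof.
move=> lX i j; apply: contraNeq => /lX /andP[].
by case: (par i) (par j) => [] [].
Qed.

Lemma homogeneous_true_split X : homogeneous true X ->
  exists Y Z, [/\ raising Y, lowering Z & X = Y + Z].
Proof.
move=> hX; exists (\matrix_(i, j) (if ~~ par i && par j then X i j else 0)).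
exists (\matrix_(i, j) (if par i && ~~ par j then X i j else 0)); split.
- by move=> i j; rewrite mxE; case: ifP; rewrite ?eqxx.
- by move=> i j; rewrite mxE; case: ifP; rewrite ?eqxx.
apply/matrixP => i j; rewrite !mxE; have := hX i j.
by case: (par i) (par j) => [] [] /= X0; rewrite ?addr0 ?add0r // X0.
Qed.

Lemma raising_delta i j : ~~ par i -> par j -> raising (delta_mx i j).
Proof.
move=> evi odj k l; rewrite mxE.
by case: andP => [[/eqP-> /eqP->]|_]; rewrite ?eqxx // evi odj.
Qed.

Definition all_even N (I : mi n m N) : Prop := forall a, ~~ par (I a).

Section KilledByRaising.
Variables (p q : nat) (row : nat -> nat) (w : mtens F n m p q).
Hypotheses (F_pchar0 : [pchar F] =i pred0) (row_lt : forall k : 'I_p, (row k < n)%N).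
Hypothesis w_row_symmetric : forall K, row_symmetric row (lslice K w).
Hypothesis w_all_even0 : forall I K, all_even I -> w (I, K) = 0.
Hypothesis w_raising0 : forall Y, raising Y -> mact true Y w = 0.
Implicit Types (I : mi n m p) (K : mi n m q) (a k : 'I_p).

Definition row_label k : 'I_(n + m) := lshift m (Ordinal (row_lt k)).
Definition offdiag I : {set 'I_p} := [set k : 'I_p | I k != row k :> nat].

Lemma par_row_label k : ~~ par (row_label k).
Proof. by rewrite /par -ltnNge row_lt. Qed.

Lemma offdiag_upd_sub I k r : k \in offdiag I -> offdiag (upd I k r) \subset offdiag I.
Proof.
move=> offk; apply/subsetP => a; have [->|neq_ak] := eqVneq a k; first by rewrite offk.
by rewrite !inE upd_ne.
Qed.

Lemma offdiag_upd_row_label I k :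
  k \in offdiag I -> (#|offdiag (upd I k (row_label k))| < #|offdiag I|)%N.
Proof.
move=> offk; apply: proper_card; rewrite properE offdiag_upd_sub //=.
by apply/subsetPn; exists k; rewrite // inE upd_at eqxx.
Qed.

(* Apply the raising operator sending the odd label [I k] to the label of the row of [k]
   and take the coefficient at [J], which is [I] with [k] so relabelled: up to one
   common sign, each site of the row of [k] with that label contributes [w (I, K)]; all other
   contributions are coefficients of [w] with fewer off-diagonal sites than [I]. *)
Lemma coef_odd_site0 I K k : par (I k) ->
  (forall I' K', (#|offdiag I'| < #|offdiag I|)%N -> w (I', K') = 0) -> w (I, K) = 0.
Proof.
move=> odk IHw; set j := I k; pose i := row_label k; pose J := upd I k i.
have offk : k \in offdiag I.
  by rewrite inE; apply: contraTneq odk; rewrite /par -ltnNge => ->.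
have lt_JI : (#|offdiag J| < #|offdiag I|)%N by apply: offdiag_upd_row_label.
pose x := lslice K w; pose Y : 'M[F]_(n + m) := delta_mx i j.
pose site a := site_act true a Y x J.
have rY : raising Y by apply: raising_delta; rewrite ?par_row_label.
have Jk : J k = i by rewrite upd_at.
have site_row a : row a = row k -> J a = i -> site a = site k.
  move=> eq_row Ja; have hY := raising_homogeneous rY.
  by rewrite /site (site_act_row_symmetric hY (w_row_symmetric K) eq_row) ?Ja ?Jk ?par_row_label.
have site_off a : row a != row k -> site a = 0.
  move=> neq_row; rewrite /site site_act_delta; case: eqP => // Ja.
  rewrite [x _]ffunE IHw ?mulr0 //; apply: leq_ltn_trans lt_JI.
  by apply/subset_leq_card/offdiag_upd_sub; rewrite inE Ja eq_sym.
have sum_sites : \sum_a site a = site k *+ #|[pred a : 'I_p | (row a == row k) && (J a == i)]|.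
  rewrite -sumr_const [RHS]big_mkcond; apply: eq_bigr => a _ /=.
  rewrite inE; have [eq_row|/site_off //] := eqVneq (row a) (row k).
  have [Ja|neq_Ja] := eqVneq (J a) i; first exact: site_row.
  by rewrite /site site_act_delta (negPf neq_Ja).
have := congr1 (fun u : mtens F n m p q => u (J, K)) (w_raising0 rY).
rewrite mactE [RHS]ffunE [X in _ + _ * X](_ : _ = 0); last first.
  by rewrite tens_actE !big1 // => c _; rewrite big1 // => r _; rewrite ffunE IHw ?mulr0.
rewrite mulr0 addr0 sum_ffunE sum_sites => /eqP; rewrite -mulr_natr mulf_eq0.
rewrite (proj1 (pcharf0P F) F_pchar0) /site site_act_delta Jk eqxx mulf_eq0 signr_eq0 /=.
case/orP => [|/eqP /card0_eq /(_ k)]; last by rewrite !inE Jk !eqxx.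
by rewrite upd_upd upd_id ffunE => /eqP.
Qed.

Lemma killed_by_raising_eq0 : w = 0.
Proof.
apply/ffunP => -[I K]; rewrite [RHS]ffunE.
have [d] := ubnP #|offdiag I|; elim: d I K => // d IHd I K; rewrite ltnS => le_d.
have [k odk|all_ev] := pickP (fun k => par (I k)); last first.
  by apply: w_all_even0 => k; rewrite all_ev.
have IHw I' K' : (#|offdiag I'| < #|offdiag I|)%N -> w (I', K') = 0.
  by move=> lt_I; apply: IHd; apply: leq_trans lt_I le_d.
exact: coef_odd_site0 odk IHw.
Qed.

End KilledByRaising.
End Raising.

Section EvenPart.
Variables (F : fieldType) (n m : nat).

Definition no_even_part N (x : tens F n m N) : Prop := forall I, all_even I -> x I = 0.

Lemma basis_no_even_part N (I : mi n m N) a : par (I a) -> no_even_part (basis F I).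
Proof. by move=> odI J /(_ a); rewrite basisE; case: eqP => // ->; rewrite odI. Qed.

Lemma tens_act_lowering_no_even_part N b X (x : tens F n m N) :
  lowering X -> no_even_part (tens_act b X x).
Proof.
move=> lX I evI; rewrite tens_actE !big1 // => a _; rewrite big1 // => i _.
have [->|/lX] := eqVneq (X (I a) i) 0; first by rewrite mulr0 mul0r.
by rewrite (negPf (evI a)).
Qed.

Lemma catt_no_even_partl p q (x : tens F n m p) (y : tens F n m q) :
  no_even_part x -> no_even_part (catt x y).
Proof. by move=> x0 I evI; rewrite ffunE x0 ?mul0r // => a; rewrite ffunE evI. Qed.

Lemma catt_no_even_partr p q (x : tens F n m p) (y : tens F n m q) :
  no_even_part y -> no_even_part (catt x y).
Proof. by move=> y0 I evI; rewrite ffunE y0 ?mulr0 // => a; rewrite ffunE evI. Qed.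

Lemma ysym_no_even_part N row col (x : tens F n m N) :
  no_even_part x -> no_even_part (ysym row col x).
Proof.
move=> x0 I evI; rewrite sum_ffunE big1 // => t _; rewrite sum_ffunE big1 // => s _.
by rewrite ffun_scaleE permactM permactE x0 ?mulr0 // => a; rewrite pactVE.
Qed.

End EvenPart.

(** * The invariant element *)

Section InsertThetaCoefficients.
Variables (F : fieldType) (n m p N q : nat) (rs cs rt ct : nat -> nat).
Implicit Types (x : tens F n m p) (y : tens F n m q) (L : mi n m N).

Lemma insert_theta_eq0l x y :
  (forall L, ysym rs cs (catt x (basis F L)) = 0) -> insert_theta N rs cs rt ct x y = 0.
Proof. by move=> x0; rewrite /insert_theta big1 // => L _; rewrite /embed x0 linear0l scaler0. Qed.

Lemma insert_theta_eq0r x y :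
  (forall L, ysymt rt ct (catt (basis F L) y) = 0) -> insert_theta N rs cs rt ct x y = 0.
Proof. by move=> y0; rewrite /insert_theta big1 // => L _; rewrite /embed y0 linear0r scaler0. Qed.

Lemma insert_theta_all_even0l x y I K : no_even_part x -> all_even I ->
  insert_theta N rs cs rt ct x y (I, K) = 0.
Proof.
move=> x0 evI; rewrite sum_ffunE big1 // => L _; rewrite ffun_scaleE tprodE.
by rewrite (ysym_no_even_part _ _ (catt_no_even_partl _ x0)) ?mul0r ?mulr0.
Qed.

Lemma insert_theta_all_even0r x y I K : all_even I ->
  (forall L, all_even L -> ysymt rt ct (catt (basis F L) y) = 0) ->
  insert_theta N rs cs rt ct x y (I, K) = 0.
Proof.
move=> evI y0; rewrite sum_ffunE big1 // => L _; rewrite ffun_scaleE tprodE.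
have [a odL|evL] := pickP (fun a => par (L a)).
  have no_evL := catt_no_even_partr x (basis_no_even_part F odL).
  by rewrite (ysym_no_even_part _ _ no_evL) ?mul0r ?mulr0.
by rewrite y0 ?ffunE ?mulr0 // => a; rewrite evL.
Qed.

End InsertThetaCoefficients.

Lemma sum_modn (V : nmodType) (g : nat -> V) n h :
  \sum_(a < n * h) g (a %% n)%N = (\sum_(i < n) g i) *+ h.
Proof.
rewrite -(big_mkord xpredT (fun a => g (a %% n)%N)) -(big_mkord xpredT g) mulnC big_nat_mul.
rewrite -[X in _ *+ X]subn0 -sumr_const_nat; apply: eq_bigr => i _.
rewrite mulSn -[X in index_iota X _]add0n big_addn addnK.
by apply: eq_big_nat => j /andP[_ lt_jn]; rewrite addnC modnMDl modn_small.
Qed.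

Lemma sum_divn (V : nmodType) (g : nat -> V) h m :
  \sum_(c < h * m) g (c %/ h)%N = (\sum_(j < m) g j) *+ h.
Proof.
rewrite -(big_mkord xpredT (fun c => g (c %/ h)%N)) -(big_mkord xpredT g) mulnC big_nat_mul.
rewrite -sumrMnl; apply: eq_bigr => j _.
rewrite (eq_big_nat _ _ (F2 := fun=> g j)).
  by rewrite sumr_const_nat mulSn addnK.
move=> c /andP[le_jc lt_cj]; have lt_h : (c - j * h < h)%N by lia.
by rewrite -(subnKC le_jc) divnMDl ?divn_small ?addn0 // (leq_ltn_trans _ lt_h).
Qed.

Section Invariance.
Variables (F : fieldType) (n m h : nat).
Hypothesis F_pchar0 : [pchar F] =i pred0.
Implicit Types (X Y : 'M[F]_(n + m)) (L : mi n m (n * m)).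

Local Notation vI := (basis F (Ih n m h)).
Local Notation vJ := (basis F (Jh n m h)).
Local Notation es := (@ysym F n m (n * h + n * m) (s_row n) (s_col n)).
Local Notation et := (@ysymt F n m (n * m + h * m) (t_row n m h) (t_col n m h)).
Local Notation insert :=
  (@insert_theta F n m (n * h) (n * m) (h * m) (s_row n) (s_col n) (t_row n m h) (t_col n m h)).

Lemma val_Ih a : Ih n m h a = (a %% n)%N :> nat.
Proof. by rewrite ffunE. Qed.

Lemma val_Jh c : Jh n m h c = (n + c %/ h)%N :> nat.
Proof. by rewrite ffunE. Qed.

Lemma all_even_Ih : all_even (Ih n m h).
Proof.
move=> a; have := leq_ltn_trans (leq0n a) (ltn_ord a); rewrite muln_gt0 => /andP[n_gt0 _].
by rewrite /par val_Ih -ltnNge ltn_pmod.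
Qed.

Lemma par_Jh c : par (Jh n m h c).
Proof. by rewrite /par val_Jh leq_addr. Qed.

Lemma two_neq0 : 2%:R != 0 :> F.
Proof. by rewrite (proj1 (pcharf0P F) F_pchar0). Qed.

Lemma ysym_upd_Ih0 a r L : ~~ par r -> r != Ih n m h a ->
  es (catt (basis F (upd (Ih n m h) a r)) (basis F L)) = 0.
Proof.
rewrite {1}/par -ltnNge => lt_rn neq_r; have n_gt0 := leq_ltn_trans (leq0n r) lt_rn.
have lt_a' : (a %/ n * n + r < n * h)%N.
  have : (a %/ n < h)%N by rewrite ltn_divLR // (leq_trans (ltn_ord a)) // mulnC.
  by move=> lt_ah; nia.
pose a' := Ordinal lt_a'.
have Ih_a' : Ih n m h a' = r by apply: val_inj; rewrite /= val_Ih /= modnMDl modn_small.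
have neq_a' : a' != a by apply: contraNneq neq_r => <-; rewrite Ih_a'.
rewrite ysymE catt_basis (antisymmetrizer_basis0 two_neq0 (k := lshift _ a) (l := lshift _ a')).
- exact: linear0.
- by rewrite eq_lshift eq_sym.
- by rewrite /s_col /= divnMDl // (divn_small lt_rn) addn0.
- by rewrite !catmiL upd_at upd_ne.
by rewrite catmiL upd_at /par -ltnNge.
Qed.

Lemma ysymt_upd_Jh0 c r L : par r -> r != Jh n m h c ->
  et (catt (basis F L) (basis F (upd (Jh n m h) c r))) = 0.
Proof.
rewrite {1}/par => le_nr neq_r.
have h_gt0 : (0 < h)%N.
  by have := leq_ltn_trans (leq0n c) (ltn_ord c); rewrite muln_gt0 => /andP[].
have lt_ch := ltn_pmod c h_gt0.
have lt_c' : ((r - n) * h + c %% h < h * m)%N by have := ltn_ord r; nia.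
pose c' := Ordinal lt_c'.
have Jh_c' : Jh n m h c' = r.
  by apply: val_inj; rewrite /= val_Jh /= divnMDl // (divn_small lt_ch) addn0 subnKC.
have neq_c' : c' != c by apply: contraNneq neq_r => <-; rewrite Jh_c'.
rewrite ysymtE catt_basis (symmetrizer_basis0 two_neq0 (k := rshift _ c) (l := rshift _ c')).
- exact: linear0.
- by rewrite eq_rshift eq_sym.
- by rewrite /t_row /= !ltnNge !leq_addr /= !addKn modnMDl modn_mod.
- by rewrite !catmiR upd_at upd_ne.
by rewrite catmiR upd_at /par.
Qed.

Lemma t_col_lt k : (k < n * m + h * m)%N -> (t_col n m h k < m)%N.
Proof.
rewrite /t_col; case: (ltnP k (n * m)) => [lt_k _|le_k lt_k].
  by rewrite ltn_divLR 1?mulnC //; move: lt_k; case: (n).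
have h_gt0 : (0 < h)%N by move: lt_k; case: (h) => //; rewrite mul0n addn0 ltnNge le_k.
by rewrite ltn_divLR // mulnC; lia.
Qed.

(* The [n * m + 1] even entries do not fit into the [m] columns of [t]. *)
Lemma ysymt_even0 c r L : all_even L -> ~~ par r ->
  et (catt (basis F L) (basis F (upd (Jh n m h) c r))) = 0.
Proof.
move=> evL evr; rewrite catt_basis (@ysymt_basis_crowded0 F n m _ two_neq0 _ _ m) //.
  by move=> k; apply: t_col_lt.
set K := catmi _ _.
have evK : rshift (n * m) c |: [set lshift (h * m) a | a : 'I_(n * m)] \subset even_sites K.
  apply/subsetP => k; rewrite !inE => /orP[/eqP ->|/imsetP[a _ ->]].
    by rewrite catmiR upd_at.
  by rewrite catmiL.
apply: leq_trans (subset_leq_card evK).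
rewrite cardsU1 card_imset ?card_ord; last exact: lshift_inj.
rewrite (_ : _ \notin _) ?add1n 1?mulnC //.
by apply/imsetP => -[a _ /eqP]; rewrite eq_rlshift.
Qed.

Lemma sum_Ih (V : nmodType) (g : 'I_(n + m) -> V) :
  \sum_a g (Ih n m h a) = (\sum_(i < n) g (lshift m i)) *+ h.
Proof.
pose g_nat k := oapp g 0 (insub k).
have gE i : g i = g_nat (val i) by rewrite /g_nat valK.
rewrite (eq_bigr (fun i : 'I_n => g_nat i)) -?sum_modn => [|i _]; last by rewrite gE.
by apply: eq_bigr => a _; rewrite gE /= val_Ih.
Qed.

Lemma sum_Jh (V : nmodType) (g : 'I_(n + m) -> V) :
  \sum_c g (Jh n m h c) = (\sum_(j < m) g (rshift n j)) *+ h.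
Proof.
pose g_nat k := oapp g 0 (insub (n + k)%N).
have gE i k : val i = (n + k)%N -> g i = g_nat k by rewrite /g_nat => <-; rewrite valK.
rewrite (eq_bigr (fun j : 'I_m => g_nat j)) -?sum_divn => [|j _]; last exact: gE.
by apply: eq_bigr => c _; apply: gE; rewrite /= val_Jh.
Qed.

Lemma strE X :
  str X = \sum_(i < n) X (lshift m i) (lshift m i) - \sum_(j < m) X (rshift n j) (rshift n j).
Proof.
rewrite /str big_split_ord /= -sumrN; congr (_ + _); apply: eq_bigr => i _.
  by rewrite /par /= leqNgt ltn_ord mul1r.
by rewrite /par /= leq_addr mulN1r.
Qed.

Lemma insert_tens_act_Ih X y : homogeneous false X ->
  insert (tens_act false X vI) y = ((\sum_(i < n) X (lshift m i) (lshift m i)) *+ h) *: insert vI y.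
Proof.
move=> hX; rewrite -(sum_Ih (fun i => X i i)) scaler_suml tens_act_basis linear_sumlz.
apply: eq_bigr => a _; rewrite linear_sumlz (bigD1 (Ih n m h a)) //= big1 => [|r neq_r].
  by rewrite addr0 linearZl_LR upd_id mul1r.
rewrite linearZl_LR /=; have [odr|evr] := boolP (par r).
  by rewrite hX ?mulr0 ?scale0r // odr (negPf (all_even_Ih a)).
by rewrite insert_theta_eq0l ?scaler0 // => L; apply: ysym_upd_Ih0.
Qed.

Lemma insert_tens_act_Jh X x : homogeneous false X ->
  insert x (tens_act false (dualmx false X) vJ) =
  - ((\sum_(j < m) X (rshift n j) (rshift n j)) *+ h) *: insert x vJ.
Proof.
move=> hX; rewrite -(sum_Jh (fun j => X j j)) scaleNr scaler_suml -sumrN tens_act_basis linear_sumr.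
apply: eq_bigr => c _; rewrite linear_sumr (bigD1 (Jh n m h c)) //= big1 => [|r neq_r].
  by rewrite addr0 linearZr_LR upd_id mxE /= !mul1r scaleNr.
rewrite linearZr_LR /=; have [odr|evr] := boolP (par r).
  by rewrite insert_theta_eq0r ?scaler0 // => L; apply: ysymt_upd_Jh0.
by rewrite mxE hX ?mulr0 ?oppr0 ?mulr0 ?scale0r // (negPf evr) par_Jh.
Qed.

Lemma mact_insert_Ih_Jh b X : homogeneous b X ->
  mact b X (insert vI vJ) = insert (tens_act b X vI) vJ + insert vI (tens_act b (dualmx b X) vJ).
Proof.
move=> hX; have grading_Ih : grading b vI = vI.
  rewrite grading_basis [parity _]big1 ?andbF ?scale1r // => a _.
  by rewrite odd_atE; apply/negbTE/all_even_Ih.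
by rewrite (mact_insert_theta _ _ _ _ _ _ _ hX) grading_Ih.
Qed.

Lemma mact_even_insert X : homogeneous false X ->
  mact false X (insert vI vJ) = (str X *+ h) *: insert vI vJ.
Proof.
move=> hX; rewrite (mact_insert_Ih_Jh hX) (insert_tens_act_Ih _ hX) (insert_tens_act_Jh _ hX).
by rewrite -scalerDl strE mulrnBl.
Qed.

Lemma mact_raising_insert Y : raising Y -> mact true Y (insert vI vJ) = 0.
Proof.
move=> rY; rewrite (mact_insert_Ih_Jh (raising_homogeneous rY)) !tens_act_basis.
have Y_Ih r a : Y r (Ih n m h a) = 0.
  by apply: contraNeq (all_even_Ih a) => /rY /andP[].
have Y_Jh r c : Y (Jh n m h c) r = 0.
  by apply: contraTeq (par_Jh c) => /rY /andP[].
rewrite !big1 ?linear0l ?linear0r ?addr0 // => a _; rewrite big1 // => r _.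
  by rewrite mxE Y_Jh !mulr0 oppr0 mulr0 scale0r.
by rewrite Y_Ih mulr0 scale0r.
Qed.

Lemma ysymt_tens_act_lowering0 X L : lowering X -> all_even L ->
  et (catt (basis F L) (tens_act true (dualmx true X) vJ)) = 0.
Proof.
move=> lX evL; rewrite tens_act_basis linear_sumr linear_sum big1 // => c _.
rewrite linear_sumr linear_sum big1 // => r _; rewrite linearZr_LR linearZ /=.
have [X0|/lX /andP[_ evr]] := eqVneq (X (Jh n m h c) r) 0.
  by rewrite mxE X0 mulr0 oppr0 mulr0 scale0r.
by rewrite ysymt_even0 ?scaler0.
Qed.

Lemma mact_lowering_insert X : lowering X -> mact true X (insert vI vJ) = 0.
Proof.
move=> lX; have hX := lowering_homogeneous lX; have XvE := mact_insert_Ih_Jh hX.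
apply: (killed_by_raising_eq0 (row := s_row n) F_pchar0).
- move=> k; rewrite /s_row ltn_pmod //.
  by have := leq_ltn_trans (leq0n k) (ltn_ord k); rewrite -mulnDr muln_gt0 => /andP[].
- move=> K; rewrite XvE linearD.
  by apply: row_symmetricD; apply: lslice_insert_theta_row_symmetric.
- move=> I K evI; have no_evX : no_even_part (tens_act true X vI).
    exact: tens_act_lowering_no_even_part.
  rewrite XvE ffun_addE [X in X + _](insert_theta_all_even0l _ _ _ _ _ _ no_evX evI) add0r.
  by apply: insert_theta_all_even0r => // L evL; apply: ysymt_tens_act_lowering0.
move=> Y rY; have hY := raising_homogeneous rY.
have := mact_supercomm (insert vI vJ) hY hX.
rewrite (mact_raising_insert rY) linear0 scaler0 subr0 => ->.
rewrite mact_even_insert; last exact: (homogeneous_supercomm hY hX).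
by rewrite (str_supercomm hY hX) mul0rn scale0r.
Qed.

End Invariance.

Theorem theorem3p4 (F : fieldType) (n m h : nat) (HF : [pchar F] =i pred0) :
  sl_invariant
    (\sum_(L : mi n m (n * m))
        (-1) ^+ alpha L *:
          tprod
            (ysym (s_row n) (s_col n) (basis F (catmi (Ih n m h) L)))
            (ysymt (t_row n m h) (t_col n m h) (basis F (catmi L (Jh n m h))))).
Proof.
under eq_bigr => L _ do rewrite -!catt_basis.
rewrite -/(insert_theta _ _ _ _ _ _ _) => -[] X hX strX; last first.
  by rewrite mact_even_insert // strX mul0rn scale0r.
have [Y [Z [rY lZ ->]]] := homogeneous_true_split hX.
by rewrite mactDl mact_raising_insert // mact_lowering_insert // addr0.
Qed.
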